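(* Suppose $0\le q\le n-1$ and let $\Theta:C\setminus\{o\}\to(0,\infty)$ be continuous and positively homogeneous of degree $-q$. Let $E_1,E_2$ be $(C,\Theta)$-close sets. Then $$\overline{V}_\Theta(E_1+E_2)^{\frac{1}{n-q}}\le\overline{V}_\Theta(E_1)^{\frac{1}{n-q}}+\overline{V}_\Theta(E_2)^{\frac{1}{n-q}}.$$ Moreover, if $q\in[0,n-1)$, equality holds if and only if $E_1$ and $E_2$ are dilates of each other.
   Context: $C\subset\mathbb{R}^n$ ($n\ge2$) is a pointed closed convex cone with nonempty interior. A $C$-pseudo-cone is a nonempty closed convex set $E$ with $o\notin E$, $\lambda x\in E$ for all $x\in E,\lambda\ge1$, and recession cone $\{x:E+x\subset E\}$ equal to $C$. $\overline{V}_\Theta(E)=\int_{C\setminus E}\Theta\,d\mathcal{H}^n$. For $0\le q\le n-1$, a $(C,\Theta)$-close set is a $C$-pseudo-cone $E$ with $\overline{V}_\Theta(E)<\infty$. $E_1+E_2$ denotes the Minkowski sum. Dilates: $E_2=\lambda E_1$ for some $\lambda>0$. *)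

(* Defs.v *)
From HB Require Import structures.
From mathcomp Require Import all_boot all_order all_algebra.
From mathcomp Require Import all_classical all_reals all_analysis.
Set Implicit Arguments. Unset Strict Implicit. Unset Printing Implicit Defensive.
Import Order.TTheory GRing.Theory Num.Theory.
Import numFieldNormedType.Exports.
Local Open Scope classical_set_scope.
Local Open Scope ring_scope.

Section Defs.
Variable R : realType.

(* Integral over R^n w.r.t. n-dimensional Lebesgue measure (= H^n),
   for nonnegative (Borel) functions, as the iterated one-dimensional
   Lebesgue integral (Tonelli).  A vector of 'rV_(n.+1) is written
   row_mx x y with x : 'rV_1, y : 'rV_n. *)
Fixpoint lebesgue_int_rV (n : nat) : ('rV[R]_n -> \bar R) -> \bar R :=
  match n return ('rV[R]_n -> \bar R) -> \bar R with
  | 0 => fun f => f 0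
  | k.+1 => fun f =>
      (\int[@lebesgue_measure R]_(t in setT)
         lebesgue_int_rV (fun y : 'rV[R]_k => f (row_mx (const_mx (t : R) : 'rV[R]_1) y : 'rV[R]_(1 + k))))%E
  end.

Definition convex_set n (A : set 'rV[R]_n) :=
  forall x y (a : R), A x -> A y -> 0 <= a <= 1 -> A (a *: x + (1 - a) *: y).

Definition pointed_cone n (C : set 'rV[R]_n) :=
  [/\ closed C, convex_set C,
      (forall x (l : R), C x -> 0 <= l -> C (l *: x)),
      (forall x, C x -> C (- x) -> x = 0)
    & (interior C !=set0)].

Definition recession_cone n (E : set 'rV[R]_n) :=
  [set x | forall y, E y -> E (y + x)].

Definition pseudo_cone n (C E : set 'rV[R]_n) :=
  (E !=set0) /\ closed E /\ convex_set E /\ ~ E 0 /\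
  (forall x (l : R), E x -> 1 <= l -> E (l *: x)) /\
  recession_cone E = C.

Definition covolume n (C : set 'rV[R]_n) (Theta : 'rV[R]_n -> R)
    (E : set 'rV[R]_n) : \bar R :=
  lebesgue_int_rV (fun x => if x \in C `\` E then (Theta x)%:E else 0%E).

Definition close_set n C Theta (E : set 'rV[R]_n) :=
  pseudo_cone C E /\ (covolume C Theta E < +oo)%E.

Definition minkowski_sum n (A B : set 'rV[R]_n) :=
  [set z | exists x y, A x /\ B y /\ z = x + y].

Definition dilate n (l : R) (A : set 'rV[R]_n) := [set l *: x | x in A].

End Defs.

(* Main.v *)
(** Let p = n - q >= 1 and, for x in C, rho_E(x) = inf {r > 0 | r x \in E}, so
that the covolume of E is the Theta-mass of {rho_E > 1}.  Homogeneity of Theta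
makes the mass of {rho > t} equal to t^-p times the mass of {rho > 1} for every
rho that is homogeneous of degree -1.  Integrating this over t in a set S (layer
cake) turns the mass of {rho > 1}, up to the constant \int_S t^-p dt, into the
integral of |S cap ]0, rho[|, which avoids polar coordinates.

Since rho_{E1+E2} <= rho_{E1} + rho_{E2}, a Minkowski inequality in rho is
needed.  For p > 1 take S = ]1, oo[: the integrand (rho - 1)^+ is convex in rho,
and equality forces the normalised rho_1, rho_2 never to lie strictly on
opposite sides of 1; a point of one set outside the dilate of the other would
produce an open set where they do.  For p = 1 the constant is infinite; one
compares S = ]2, b[ for the sum with S = ]1, b[ for the summands and lets
b tend to infinity, the ratio of the two constants tending to 1. *)

Require Import Defs.
From HB Require Import structures.
From mathcomp Require Import all_boot all_order all_algebra.
From mathcomp Require Import ring lra.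
From mathcomp Require Import all_classical all_reals all_analysis.
From mathcomp Require Import measurable_realfun.
Import Order.TTheory GRing.Theory Num.Theory.
Import numFieldNormedType.Exports.
Local Open Scope classical_set_scope.
Local Open Scope ring_scope.

Set Implicit Arguments.
Unset Strict Implicit.
Unset Printing Implicit Defensive.

(** * Lebesgue measure on row vectors *)

(** The pushforward is exposed only through its values on sets, which hides the dependence of its
    structure on the measurability proof. *)
Lemma pushforward_is_measure d1 d2 (T1 : measurableType d1)
    (T2 : measurableType d2) (R : realType) (m : {measure set T1 -> \bar R})
    (f : T1 -> T2) : measurable_fun setT f ->
  exists mu : {measure set T2 -> \bar R}, forall A, mu A = m (f @^-1` A).
Proof.
move=> mf.
by exists (measure_function_pushforward__canonical__measure_function_Measure m mf).
Qed.

(** Uniqueness of Lebesgue measure: the right-hand side is a multiple of a pushforward, hence a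
    measure, and it agrees with length on half-open intervals. *)
Lemma lebesgue_measure_scale (R : realType) (l : R) (A : set R) : 0 < l ->
  measurable A ->
  lebesgue_measure A =
  (l%:E * lebesgue_measure ((fun t : R => (l * t)%R) @^-1` A))%E.
Proof.
move=> l0 mA.
have ml : measurable_fun setT ((fun t => l * t) : measurableTypeR R -> measurableTypeR R).
  exact: mulrl_measurable.
have l0' : 0 <= l by exact: ltW.
have [P PE] := pushforward_is_measure (@lebesgue_measure R) ml.
rewrite -PE.
rewrite (@lebesgue_measure_unique R (mscale (NngNum l0') P) _ A mA) // => X [[a b] /= _ <-].
rewrite /mscale /= PE.
rewrite (_ : _ @^-1` _ = `]l^-1 * a, l^-1 * b]%classic); last first.
  by apply/seteqP; split=> x /=; rewrite !in_itv /= ltr_pdivrMl // ler_pdivlMl.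
rewrite lebesgue_measure_itv [X in (_ * X)%E]lebesgue_measure_itv /= !lte_fin ltr_pM2l ?invr_gt0//.
case: ifP => ab; last by rewrite mule0.
by rewrite -!EFinB -EFinM -mulrBr mulrA mulfV ?mul1r // gt_eqF.
Qed.

Lemma ge0_integral_lebesgue_scale (R : realType) (l : R) (f : R -> \bar R) :
  0 < l -> (forall t, 0 <= f t)%E -> measurable_fun setT f ->
  (\int[@lebesgue_measure R]_t f (l * t)%R =
   l^-1%:E * \int[@lebesgue_measure R]_t f t)%E.
Proof.
move=> l0 f0 mf.
have ml : measurable_fun setT ((fun t => l * t) : measurableTypeR R -> measurableTypeR R).
  exact: mulrl_measurable.
have l0' : 0 <= l by exact: ltW.
have [P PE] := pushforward_is_measure (@lebesgue_measure R) ml.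
have -> : (\int[@lebesgue_measure R]_t f t = \int[mscale (NngNum l0') P]_t f t)%E.
  apply: eq_measure_integral => A mA _.
  by have := lebesgue_measure_scale l0 mA; rewrite -PE => E; rewrite [LHS]E.
rewrite ge0_integral_mscale//=.
have -> : (\int[P]_t f t = \int[@lebesgue_measure R]_t f (l * t)%R)%E.
  rewrite -(ge0_integral_pushforward ml (@lebesgue_measure R) (D := setT))//.
  apply: (eq_measure_integral
    (measure_function_pushforward__canonical__measure_function_Measure
      (@lebesgue_measure R) ml)) => A mA _.
  by rewrite PE.
by rewrite muleA -EFinM mulVf ?mul1e ?gt_eqF.
Qed.

(* Matrices carry no measurable structure, so Lebesgue measure on R^n is
   transported from a measure space [T]; [sc l] is the homothety of ratio [l].
   [rV_int_off0] is what makes the arbitrary value of Theta at 0 harmless. *)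
Record rV_model (R : realType) n d (T : measurableType d)
  (m : {sigma_finite_measure set T -> \bar R}) (phi : T -> 'rV[R]_n)
  (sc : R -> T -> T) : Prop := RVModel {
  rV_coordM : forall i, measurable_fun setT (fun x => phi x 0 i);
  rV_intE : forall f, (forall v, 0 <= f v)%E -> measurable_fun setT (f \o phi) ->
    lebesgue_int_rV f = (\int[m]_x f (phi x))%E;
  rV_int_off0 : (0 < n)%N -> forall f g, (forall v, 0 <= f v)%E ->
    measurable_fun setT (f \o phi) -> (forall v, v != 0 -> g v = f v) ->
    lebesgue_int_rV g = lebesgue_int_rV f;
  rV_scE : forall l x, phi (sc l x) = l *: phi x;
  rV_scM : forall l, measurable_fun setT (sc l);
  rV_sc_int : forall l (F : T -> \bar R), 0 < l -> (forall x, 0 <= F x)%E ->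
    measurable_fun setT F ->
    (\int[m]_x F (sc l x) = (l^-1 ^+ n)%:E * \int[m]_x F x)%E;
  rV_box_pos : forall (c : 'rV[R]_n) r, 0 < r ->
    (0 < m [set x | forall i, (`|phi x 0 i - c 0 i| < r)%R])%E }.

Lemma rV_boxM (R : realType) n d (T : measurableType d) (phi : T -> 'rV[R]_n)
  (c : 'rV[R]_n) (r : R) :
  (forall i, measurable_fun setT (fun x => phi x 0 i)) ->
  measurable [set x | forall i, `|phi x 0 i - c 0 i| < r].
Proof.
move=> mphi.
rewrite (_ : mkset _ = \bigcap_(i in [set: 'I_n])
    [set x | `|phi x 0 i - c 0 i| < r]); last first.
  by apply/seteqP; split=> x /= => [h i _|h i]; exact: h.
apply: fin_bigcap_measurable => // i _.
rewrite (_ : mkset _ = (fun x => phi x 0 i) @^-1` ball (c 0 i) r).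
  rewrite -[X in measurable X]setTI; apply: mphi => //.
  by apply: measurable_ball.
by apply/seteqP; split=> x /=; rewrite /ball /= distrC.
Qed.

(** In dimension 0 the iterated integral is evaluation at the only vector, that is, integration
    against a Dirac mass on one point. *)
Lemma rV_model0 (R : realType) :
  @rV_model R 0 _ unit (\d_tt)%E (fun=> 0) (fun _ => id).
Proof.
split => //.
- by move=> f f0 _; rewrite /= integral_dirac// diracT mul1e.
- by move=> l x; apply/rowP => i; have := ltn_ord i.
- move=> l F l0 F0 mF; rewrite expr0 mul1e //.
- move=> c r r0; rewrite (_ : mkset _ = setT).
    by rewrite /= diracE mem_set //= lte01.
  by apply/seteqP; split => // x _ [].
Qed.

(** Rectangles built from two exhausting sequences exhaust the product. The bundled structure lets
    Tonelli be applied again in the next dimension. *)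
Lemma product_measure_is_sigma_finite d1 d2 (T1 : measurableType d1)
    (T2 : measurableType d2) (R : realType)
    (m1 : {sigma_finite_measure set T1 -> \bar R})
    (m2 : {sigma_finite_measure set T2 -> \bar R}) :
  exists mu : {sigma_finite_measure set (T1 * T2)%type -> \bar R},
    mu = (m1 \x m2)%E :> (set (T1 * T2) -> \bar R).
Proof.
have sf : sigma_finite setT (m1 \x m2)%E.
  have /sigma_finiteP[F [TF ndF Foo]] := sigma_finiteT m1.
  have /sigma_finiteP[G [TG ndG Goo]] := sigma_finiteT m2.
  exists (fun k => F k `*` G k).
    apply/seteqP; split=> // -[x y] _.
    have [k _ Fx] : (\bigcup_k F k) x by rewrite -TF.
    have [l _ Gy] : (\bigcup_k G k) y by rewrite -TG.
    exists (maxn k l) => //; split=> /=.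
      by move: x Fx; exact/subsetPset/ndF/leq_maxl.
    by move: y Gy; exact/subsetPset/ndG/leq_maxr.
  move=> k; have [mF F_fin] := Foo k; have [mG G_fin] := Goo k.
  split; first exact: measurableX.
  by rewrite product_measure1E // lte_mul_pinfty // ge0_fin_numE.
pose sfm := Measure_isSigmaFinite.Build _ _ _ (m1 \x m2)%E sf.
pose P : {sigma_finite_measure set (T1 * T2)%type -> \bar R} :=
  HB.pack (m1 \x m2)%E sfm.
by exists P.
Qed.

(** * Adding one coordinate to a model *)

Section rV_modelS.
Variables (R : realType) (n : nat) (d : measure_display) (T : measurableType d).
Variables (m : {sigma_finite_measure set T -> \bar R}) (phi : T -> 'rV[R]_n).
Variable (sc : R -> T -> T).
Hypothesis H : rV_model m phi sc.

Let TS : measurableType _ := (measurableTypeR R * T)%type.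
Variable mS : {sigma_finite_measure set TS -> \bar R}.
Hypothesis mSE : mS = (@lebesgue_measure R \x m)%E :> (set TS -> \bar R).
Let phiS (x : TS) : 'rV[R]_n.+1 :=
  row_mx (const_mx x.1 : 'rV[R]_1) (phi x.2) : 'rV[R]_(1 + n).
Let scS (l : R) (x : TS) : TS := (l * x.1, sc l x.2).

Let phiS0 x (i : 'I_n.+1) : i = 0%N :> nat -> phiS x 0 i = x.1.
Proof.
move=> i0; have -> : i = lshift n (ord0 : 'I_1) by apply/val_inj.
apply: (etrans (row_mxEl (const_mx x.1 : 'rV[R]_1) (phi x.2) 0 ord0)).
by rewrite mxE.
Qed.

Let phiSr x (i : 'I_n) : phiS x 0 (rshift 1 i : 'I_(1 + n)) = phi x.2 0 i.
Proof. exact: (row_mxEr (const_mx x.1 : 'rV[R]_1)). Qed.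

Let case_ord (i : 'I_n.+1) : i = lshift n (ord0 : 'I_1) \/
  exists j : 'I_n, i = rshift 1 j.
Proof.
by case: (split_ordP (i : 'I_(1 + n))) => j ->; [left; rewrite ord1|right; exists j].
Qed.

Let coordMS i : measurable_fun setT (fun x => phiS x 0 i).
Proof.
have [->|[j ->]] := case_ord i.
  under eq_fun do rewrite phiS0 //.
  exact: measurable_fst.
under eq_fun do rewrite phiSr.
apply: (measurableT_comp (rV_coordM H j)); exact: measurable_snd.
Qed.

(** Tonelli identifies the iterated integral with the product one. Measurability of the inner
    integral is kept as a conjunct for the null-slice argument behind [rV_int_off0]. *)
Let intS (f : 'rV[R]_n.+1 -> \bar R) :
  (forall v, 0 <= f v)%E -> measurable_fun setT (f \o phiS) ->
  measurable_fun setT (fun t : measurableTypeR R => lebesgue_int_rV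
    (fun y : 'rV[R]_n => f (row_mx (const_mx (t : R) : 'rV[R]_1) y : 'rV[R]_(1 + n)))) /\
  lebesgue_int_rV f = (\int[mS]_x f (phiS x))%E.
Proof.
move=> f0 mf.
have E t : lebesgue_int_rV
    (fun y : 'rV[R]_n => f (row_mx (const_mx (t : R) : 'rV[R]_1) y : 'rV[R]_(1 + n)))
    = (\int[m]_y (f \o phiS) (t, y))%E.
  rewrite (rV_intE H) //.
  exact: (measurable_fun_pair2 (t : measurableTypeR R) mf).
split.
  rewrite (funext E).
  by apply: measurable_fun_fubini_tonelli_F => // x; exact: f0.
rewrite /= (funext E).
rewrite mSE (@fubini_tonelli1 _ _ _ _ _ (@lebesgue_measure R) m (f \o phiS) mf) //.
by move=> x; exact: f0.
Qed.

Lemma rV_modelS : rV_model mS phiS scS.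
Proof.
split => //.
- by move=> f f0 mf; have [] := intS f0 mf.
- move=> _ f g f0 mf gf; have [mF _] := intS f0 mf.
  rewrite /=.
  set F := (X in measurable_fun _ X) in mF.
  set G := (X in integral _ _ X).
  have GF t : t != 0 -> G t = F t.
    move=> t0; rewrite /F /G; congr lebesgue_int_rV; apply/funext => y.
    apply: gf; apply: contra t0 => /eqP/matrixP /(_ 0 (lshift n (ord0 : 'I_1))).
    move=> E; apply/eqP; move: E; rewrite [RHS]mxE => <-.
    by apply/esym/(etrans (row_mxEl _ _ 0 ord0)); rewrite mxE.
  (* [F] and [G] differ at most at [t = 0], since a nonzero first coordinate makes the whole vector
     nonzero. Written as a one-point modification of [F], [G] is visibly measurable. *)
  have -> : G = (fun t => if t == 0 then G 0 else F t).
    by apply/funext => t; case: eqVneq => [->//|/GF].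
  apply: ae_eq_integral => //.
    apply: measurable_fun_ifT => //.
    by apply: measurable_fun_eqr.
  exists [set 0]; split=> //.
    exact: lebesgue_measure_set1.
  by move=> t /= h; apply/eqP; apply: contrapT => /negP /negPf E; apply: h; rewrite E.
- move=> l [t x]; apply/rowP => i; rewrite [RHS]mxE.
  have [->|[j ->]] := case_ord i; first by rewrite !phiS0.
  by rewrite !phiSr /= (rV_scE H) mxE.
- move=> l; apply: measurable_fun_pair.
    by apply: (measurableT_comp (mulrl_measurable l)); exact: measurable_fst.
  by apply: (measurableT_comp (rV_scM H l)); exact: measurable_snd.
- move=> l F l0 F0 mF.
  have mFl : measurable_fun setT (F \o scS l).
    apply: measurableT_comp => //; apply: measurable_fun_pair.
      by apply: (measurableT_comp (mulrl_measurable l)); exact: measurable_fst.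
    by apply: (measurableT_comp (rV_scM H l)); exact: measurable_snd.
  rewrite mSE (@fubini_tonelli1 _ _ _ _ _ (@lebesgue_measure R) m (F \o scS l) mFl); last first.
    by move=> x; exact: F0.
  rewrite (@fubini_tonelli1 _ _ _ _ _ (@lebesgue_measure R) m F mF) //.
  rewrite /fubini_F /scS /=.
  (* The exponent [n.+1] splits: the inner integral contributes [l^-1 ^+ n] and the first coordinate
     one more factor [l^-1]. *)
  pose G (t : R) := (\int[m]_y F ((t : measurableTypeR R), y))%E.
  have mG : measurable_fun setT G by apply: measurable_fun_fubini_tonelli_F.
  have G0 t : (0 <= G t)%E by apply: integral_ge0.
  have E t : (\int[m]_y F ((l * t)%R : measurableTypeR R, sc l y) =
              (l^-1 ^+ n)%:E * G (l * t)%R)%E.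
    apply: (rV_sc_int H (F := fun y => F ((l * t)%R : measurableTypeR R, y))) => //.
    exact: (measurable_fun_pair2 ((l * t) : measurableTypeR R) mF).
  transitivity (\int[@lebesgue_measure R]_t
      ((l^-1 ^+ n)%:E * G (l * t)%R))%E.
    by apply: eq_integral => t _; exact: E.
  rewrite ge0_integralZl //; last 2 first.
  + by apply: (measurableT_comp mG); exact: mulrl_measurable.
  + by rewrite lee_fin exprn_ge0 // invr_ge0 ltW.
  by rewrite (ge0_integral_lebesgue_scale l0 G0 mG) muleA -EFinM exprSr.
- move=> c r r0.
  pose c' : 'rV[R]_n := \row_j c 0 (rshift 1 j : 'I_(1 + n)).
  pose c0 : R := c 0 ord0.
  have mA : measurable [set x | forall i, `|phi x 0 i - c' 0 i| < r].
    by apply: rV_boxM => //; exact: rV_coordM H.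
  have -> : [set x | forall i, `|phiS x 0 i - c 0 i| < r] =
     (ball c0 r : set (measurableTypeR R)) `*` [set x | forall i, `|phi x 0 i - c' 0 i| < r].
    apply/seteqP; split=> -[t x] /=.
      move=> h; split.
        by have := h ord0; rewrite phiS0 //= /ball /= distrC.
      by move=> i; have := h (rshift 1 i : 'I_(1 + n)); rewrite phiSr mxE.
    move=> [h1 h2] i; have [->|[j ->]] := case_ord i.
      rewrite phiS0 //=; move: h1; rewrite /ball /= distrC /c0.
      by rewrite (_ : lshift n ord0 = ord0) //; exact/val_inj.
    by have := h2 j; rewrite phiSr mxE.
  rewrite mSE product_measure1E //; last exact: measurable_ball.
  apply: mule_gt0; last exact: (rV_box_pos H).
  have := lebesgue_measure_ball c0 (ltW r0); rewrite /= => ->.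
  by rewrite lte_fin mulrn_wgt0.
Qed.

End rV_modelS.

Lemma rV_model_exists (R : realType) n :
  exists d (T : measurableType d) (m : {sigma_finite_measure set T -> \bar R})
    (phi : T -> 'rV[R]_n) (sc : R -> T -> T), rV_model m phi sc.
Proof.
elim: n => [|n [d [T [m [phi [sc H]]]]]].
  by do 5!eexists; exact: rV_model0.
have [mS mSE] := product_measure_is_sigma_finite (@lebesgue_measure R) m.
by do 5!eexists; exact: (rV_modelS H mSE).
Qed.

(** * Layer cake and Minkowski inequality *)

Lemma derivable_powR_pt (R : realType) (a x : R) : 0 < x ->
  derivable (fun t : R => t `^ a) x 1 /\
  (fun t : R => t `^ a)^`()%classic x = a * x `^ (a - 1).
Proof.
move=> x0; have H := is_derive1_powR a x0.
split; first by case: H.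
by rewrite derive1E; apply: derive_val.
Qed.

Lemma powR_continuous_pt (R : realType) (a x : R) : 0 < x ->
  {for x, continuous (fun t : R => t `^ a)}.
Proof.
move=> x0; have [H _] := derivable_powR_pt a x0.
by apply: differentiable_continuous; apply/derivable1_diffP.
Qed.

Lemma powRN_cvgy (R : realType) (a : R) : 0 < a ->
  (x `^ (- a)) @[x --> +oo] --> (0 : R).
Proof.
move=> a0; apply/cvgr0Pnorm_lt => e e0.
near=> x.
have x0 : 0 < x by near: x; exact: nbhs_pinfty_gt.
rewrite ger0_norm ?powR_ge0// powRN invf_plt ?posrE ?powR_gt0//.
have -> : e^-1 = (e^-1 `^ a^-1) `^ a.
  by rewrite -powRrM mulVf ?gt_eqF// powRr1// invr_ge0 ltW.
apply: gt0_ltr_powR => //; rewrite ?nnegrE ?powR_ge0 ?(ltW x0)//.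
Unshelve. all: by end_near. Qed.

Lemma integral_powRN_itv1y (R : realType) (p : R) : 1 < p ->
  (\int[@lebesgue_measure R]_(t in `]1%R, +oo[) ((t `^ (- p))%R)%:E =
   ((p - 1)^-1)%R%:E)%E.
Proof.
move=> p1.
have p10 : p - 1 != 0 by rewrite subr_eq0 gt_eqF.
pose F := fun t : R => - (p - 1)^-1 * t `^ (1 - p).
have dF (x : R) : 0 < x -> derivable F x 1 /\ F^`()%classic x = x `^ (- p).
  move=> x0; have [d1 d2] := derivable_powR_pt (1 - p) x0; split.
    exact: derivableM.
  have -> : F = (- (p - 1)^-1) \*: (fun t : R => t `^ (1 - p)) by [].
  rewrite derive1E deriveZ //= -derive1E d2 /GRing.scale /= addrAC subrr add0r.
  by field.
have cf : {within `[(1 : R), +oo[, continuous (fun t : R => t `^ (- p))}.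
  apply: continuous_in_subspaceT => x; rewrite inE /= in_itv /= andbT => x1.
  exact: (@powR_continuous_pt _ _ _ (lt_le_trans ltr01 x1)).
rewrite integral_itv_obnd_cbnd; last first.
  apply/measurable_EFinP/measurable_funTS; exact: measurable_powR.
rewrite (@ge0_continuous_FTC2y R _ F 1 0) //.
- by rewrite /F powR1 mulr1 -EFinB sub0r opprK.
- by move=> x _; exact: powR_ge0.
- have -> : (0 : R) = - (p - 1)^-1 * 0 by rewrite mulr0.
  apply: cvgMl_tmp; rewrite -opprB; apply: powRN_cvgy; by rewrite subr_gt0.
- by move=> x x1; have [] := dF _ (lt_trans ltr01 x1).
- apply: cvg_at_right_filter; have [d _] := dF 1 ltr01.
  by apply: differentiable_continuous; apply/derivable1_diffP.
- move=> x; rewrite in_itv /= andbT => x1.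
  by have [] := dF _ (lt_trans ltr01 x1).
Qed.

(** The layer cake constant for [p = 1]; a bounded interval is used because the integral up to
    infinity diverges. *)
Lemma integral_powRN1_itv (R : realType) (a b : R) : 0 < a -> a < b ->
  (\int[@lebesgue_measure R]_(t in `]a, b[) ((t `^ (- 1))%R)%:E =
   (ln b - ln a)%R%:E)%E.
Proof.
move=> a0 ab.
have mf D : measurable D -> measurable_fun D (EFin \o (fun t : R => t `^ (- 1))).
  move=> mD; apply/measurable_EFinP/measurable_funTS; exact: measurable_powR.
have dF (x : R) : 0 < x -> derivable (@ln R) x 1 /\ (@ln R)^`()%classic x = x `^ (- 1).
  move=> x0; have H := is_derive1_ln x0; split; first by case: H.
  by rewrite derive1E powR_inv1 ?ltW//; apply: derive_val.
have cF (x : R) : 0 < x -> {for x, continuous (@ln R)}.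
  move=> x0; have [d _] := dF _ x0.
  by apply: differentiable_continuous; apply/derivable1_diffP.
rewrite integral_itv_obnd_cbnd; last exact: mf.
rewrite integral_itv_bndo_bndc; last exact: mf.
rewrite (@continuous_FTC2 R _ (@ln R)) ?EFinB //.
- apply: continuous_in_subspaceT => x; rewrite inE /= in_itv /= => /andP[x1 _].
  exact: (@powR_continuous_pt _ _ _ (lt_le_trans a0 x1)).
- split.
  + move=> x; rewrite in_itv /= => /andP[x1 _].
    by have [] := dF _ (lt_trans a0 x1).
  + exact: cvg_at_right_filter (cF _ a0).
  + exact: cvg_at_left_filter (cF _ (lt_trans a0 ab)).
- by move=> x; rewrite in_itv /= => /andP[x1 _]; have [] := dF _ (lt_trans a0 x1).
Qed.

Section layer_cake.
Variables (R : realType) (d : measure_display) (T : measurableType d).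
Variables (m : {sigma_finite_measure set T -> \bar R}) (h : T -> R).
Hypotheses (h0 : forall x, 0 <= h x) (mh : measurable_fun setT h).

Definition superlevel_mass (r : T -> R) (t : R) : \bar R :=
  (\int[m]_x (if t < r x then h x else 0)%:E)%E.

(** Homogeneity is recorded as a scaling law of the masses rather than of [r] itself, so that the
    inequalities below live on an abstract measure space. *)
Definition homogeneous_mass (p : R) (r : T -> R) := forall t, 0 < t ->
  superlevel_mass r t = ((t `^ (- p))%:E * superlevel_mass r 1)%E.

Lemma superlevel_mass_div (a t : R) (r : T -> R) : 0 < a ->
  superlevel_mass (fun x => r x / a) t = superlevel_mass r (t * a).
Proof.
by move=> a0; apply: eq_integral => x _; rewrite ltr_pdivlMr.
Qed.

Lemma homogeneous_mass_div (p a : R) (r : T -> R) : 0 < a ->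
  homogeneous_mass p r -> homogeneous_mass p (fun x => r x / a).
Proof.
move=> a0 hr t t0; rewrite !superlevel_mass_div // mul1r (hr _ a0) (hr _ (mulr_gt0 t0 a0)).
by rewrite muleA -EFinM -powRM ?ltW.
Qed.

Lemma layer_cake (p : R) (S : set R) (r : T -> R) : measurable S ->
  (forall t, S t -> 0 < t) -> measurable_fun setT r -> homogeneous_mass p r ->
  (\int[m]_x ((h x)%:E * @lebesgue_measure R (S `&` [set t | (t < r x)%R])) =
   \int[@lebesgue_measure R]_(t in S) ((t `^ (- p))%R)%:E * superlevel_mass r 1)%E.
Proof.
move=> mS S0 mr hr.
(* Integrating [F] first in [t] gives the left-hand side, first in [x] the right-hand side. *)
pose F (z : measurableTypeR R * T) : \bar R :=
  (if (z.1 \in S) && (z.1 < r z.2) then h z.2 else 0)%:E.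
have mF : measurable_fun setT F.
  apply/measurable_EFinP; apply: measurable_fun_ifT => //.
  - apply: measurable_and.
      apply: (measurable_fun_bool true); rewrite setTI.
      rewrite (_ : _ @^-1` _ = S `*` setT); first exact: measurableX.
      by apply/seteqP; split => -[t x] /=; [move/set_mem|move=> [? _]; apply/mem_set].
    apply: measurable_fun_ltr; first exact: measurable_fst.
    by apply: (measurableT_comp mr); exact: measurable_snd.
  - by apply: (measurableT_comp mh); exact: measurable_snd.
have F0 z : (0 <= F z)%E by rewrite /F lee_fin; case: ifP.
transitivity (\int[m]_x \int[@lebesgue_measure R]_t F (t, x))%E.
  apply: eq_integral => x _.
  have mA : measurable (S `&` [set t : measurableTypeR R | (t < r x)%R]).
    apply: measurableI => //.
    by rewrite (_ : mkset _ = `]-oo, r x[%classic) //; apply/seteqP; split => y /=; rewrite in_itv.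
  have -> : @lebesgue_measure R (S `&` [set t | (t < r x)%R]) =
      (\int[@lebesgue_measure R]_t (\1_(S `&` [set t | (t < r x)%R]) t)%:E)%E.
    by rewrite integral_indic // setIT.
  rewrite -ge0_integralZl //.
  - apply: eq_integral => t _; rewrite /F /= indicE in_setI.
    have -> : (t \in [set t | t < r x]) = (t < r x).
      by apply/idP/idP => [/set_mem|H]; [|apply/mem_set].
    by case: ifP => _; rewrite ?mule1 ?mule0.
  - apply/measurable_EFinP; exact: measurable_indic.
  - by rewrite lee_fin h0.
rewrite -(@fubini_tonelli _ _ _ _ _ (@lebesgue_measure R) m F mF F0).
transitivity (\int[@lebesgue_measure R]_(t in S) superlevel_mass r t)%E.
  rewrite [RHS]integral_mkcond; apply: eq_integral => t _.
  rewrite patchE; case: ifPn => tS.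
    by rewrite /superlevel_mass /F /= tS.
  rewrite /F /=; under eq_integral do rewrite (negPf tS) /=.
  exact: integral0.
transitivity (\int[@lebesgue_measure R]_(t in S)
    ((t `^ (- p))%:E * superlevel_mass r 1))%E.
  by apply: eq_integral => t /set_mem /S0 t0; exact: hr.
rewrite ge0_integralZr //.
- by apply/measurable_EFinP/measurable_funTS; exact: measurable_powR.
- by move=> t _; rewrite lee_fin powR_ge0.
- by apply: integral_ge0 => x _; rewrite lee_fin; case: ifP.
Qed.

Lemma lebesgue_measure_itvI_lt (a x : R) :
  @lebesgue_measure R (`]a, +oo[ `&` [set t | t < x]) =
  (Num.max (x - a) 0)%:E.
Proof.
rewrite (_ : _ `&` _ = `]a, x[%classic); last first.
  apply/seteqP; split => t /=; rewrite !in_itv /= ?andbT; first by move=> [-> ->].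
  by move/andP.
rewrite lebesgue_measure_itv /= lte_fin.
by case: ltP => ax; [rewrite -EFinB max_l // subr_ge0 ltW|rewrite max_r // subr_le0].
Qed.

Lemma lebesgue_measure_itvI_lt2 (a b x : R) :
  @lebesgue_measure R (`]a, b[ `&` [set t | t < x]) =
  (Num.max (Num.min b x - a) 0)%:E.
Proof.
rewrite (_ : _ `&` _ = `]a, Num.min b x[%classic); last first.
  apply/seteqP; split => t /=; rewrite !in_itv /= lt_min.
    by move=> [/andP[-> ->] ->].
  by move=> /and3P[-> -> ->].
rewrite lebesgue_measure_itv /= lte_fin.
by case: (ltP a) => ax; [rewrite -EFinB max_l // subr_ge0 ltW|rewrite max_r // subr_le0].
Qed.

End layer_cake.

Lemma integral_eq0_support d (T : measurableType d) (R : realType)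
    (m : {measure set T -> \bar R}) (f : T -> R) :
  (forall x, 0 <= f x) -> measurable_fun setT f ->
  (\int[m]_x (f x)%:E = 0)%E -> m [set x | 0 < f x] = 0%E.
Proof.
move=> f0 mf If.
have [N [mN N0 subN]] : ae_eq m setT (fun x => (f x)%:E) (cst 0%E).
  apply/ae_eq_integral_abs => //; first exact/measurable_EFinP.
  by rewrite -[RHS]If; apply: eq_integral => x _; rewrite gee0_abs // lee_fin.
apply: (subset_measure0 _ mN _ N0).
  rewrite -[X in measurable X]setTI.
  exact: (measurable_fun_ltr (@measurable_cst _ _ _ _ _ (0 : R)) mf).
by move=> x /= fx; apply: subN => /= /(_ I) [] /eqP; rewrite gt_eqF.
Qed.

Lemma measurable_asbool d (T : measurableType d) (A : set T) : measurable A ->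
  measurable_fun setT (fun x => `[< A x >]).
Proof.
move=> mA; apply: (measurable_fun_bool true); rewrite setTI.
by rewrite (_ : _ @^-1` _ = A) //; apply/seteqP; split => x /= /asboolP.
Qed.

Lemma crossing_measurable d (T : measurableType d) (R : realType)
    (f g k : T -> R) (r s t : R) :
  measurable_fun setT f -> measurable_fun setT g -> measurable_fun setT k ->
  measurable [set x | [/\ r < f x, s < g x & k x < t]].
Proof.
move=> mf mg mk.
rewrite (_ : mkset _ = [set x | (r < f x) && ((s < g x) && (k x < t))]).
  rewrite -[X in measurable X]setTI.
  apply: (@measurable_and _ _ setT (fun x => r < f x)
    (fun x => (s < g x) && (k x < t))) => //.
    exact: (measurable_fun_ltr (@measurable_cst _ _ _ _ _ r) mf).
  apply: measurable_and.
    exact: (measurable_fun_ltr (@measurable_cst _ _ _ _ _ s) mg).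
  exact: (measurable_fun_ltr mk (@measurable_cst _ _ _ _ _ t)).
by apply/seteqP; split => x /=; [case=> -> -> ->|case/and3P].
Qed.

Lemma maxr_sub1_convex (R : realType) (s a b : R) : 0 < s < 1 ->
  Num.max (s * a + (1 - s) * b - 1) 0 <=
    s * Num.max (a - 1) 0 + (1 - s) * Num.max (b - 1) 0.
Proof.
move=> /andP[s0 s1].
(* The weights times the nonnegative gaps between the positive part and its argument: these two
   products make the goal linear for [nra]. *)
have ka : 0 <= s * (Num.max (a - 1) 0 - (a - 1)).
  by rewrite mulr_ge0 ?(ltW s0)// subr_ge0 le_max lexx.
have kb : 0 <= (1 - s) * (Num.max (b - 1) 0 - (b - 1)).
  by rewrite mulr_ge0 ?subr_ge0 ?(ltW s1)// le_max lexx.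
rewrite ge_max; apply/andP; split; first by nra.
by rewrite addr_ge0 // mulr_ge0 ?subr_ge0 ?le_max ?lexx ?orbT ?ltW.
Qed.

(** The kink of the positive part lies strictly between [b] and [a], so the convexity inequality is
    strict. *)
Lemma maxr_sub1_convex_strict (R : realType) (s a b : R) : 0 < s < 1 ->
  1 < a -> b < 1 ->
  Num.max (s * a + (1 - s) * b - 1) 0 <
    s * Num.max (a - 1) 0 + (1 - s) * Num.max (b - 1) 0.
Proof.
move=> /andP[s0 s1] a1 b1.
rewrite (@max_l _ _ (a - 1)) ?subr_ge0 ?(ltW a1)//.
rewrite (@max_r _ _ (b - 1)) ?subr_le0 ?(ltW b1)// mulr0 addr0 gt_max.
by apply/andP; split; nra.
Qed.

Section convex_mass.
Variables (R : realType) (d : measure_display) (T : measurableType d).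
Variables (m : {sigma_finite_measure set T -> \bar R}) (h : T -> R).
Hypotheses (h0 : forall x, 0 <= h x) (mh : measurable_fun setT h).

Let excessM (r : T -> R) : measurable_fun setT r ->
  measurable_fun setT (fun x => h x * Num.max (r x - 1) 0).
Proof.
move=> mr; apply: measurable_funM => //.
by apply: measurable_maxr => //; apply: measurable_funB.
Qed.

Let integral_excess (p : R) (r : T -> R) : 1 < p -> measurable_fun setT r ->
  homogeneous_mass m h p r ->
  (\int[m]_x (h x * Num.max (r x - 1) 0)%:E =
   ((p - 1)^-1)%R%:E * superlevel_mass m h r 1)%E.
Proof.
move=> p1 mr hr; rewrite -integral_powRN_itv1y // -layer_cake //.
- by apply: eq_integral => x _; rewrite EFinM lebesgue_measure_itvI_lt.
- by move=> t /=; rewrite in_itv /= andbT; exact: lt_trans.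
Qed.

(** The convexity inequality for the positive part of [r - 1] is integrated against [h]. If the
    integrals agree, the two integrands agree almost everywhere, so strict crossings of level 1 form
    a null set. *)
Lemma convex_mass (p s : R) (r1 r2 : T -> R) (r := fun x => s * r1 x + (1 - s) * r2 x) :
  1 < p -> 0 < s < 1 -> measurable_fun setT r1 -> measurable_fun setT r2 ->
  homogeneous_mass m h p r1 -> homogeneous_mass m h p r2 ->
  homogeneous_mass m h p r ->
  (superlevel_mass m h r1 1 <= 1)%E -> (superlevel_mass m h r2 1 <= 1)%E ->
  (superlevel_mass m h r 1 <= 1)%E /\
  (superlevel_mass m h r 1 = 1%E ->
   m [set x | [/\ 0 < h x, 1 < r1 x & r2 x < 1]] = 0%E).
Proof.
move=> p1 s01 mr1 mr2 hr1 hr2 hr W1 W2; have /andP[s0 s1] := s01.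
have mr : measurable_fun setT r.
  by apply: measurable_funD; apply: measurable_funM.
have c0 : 0 < (p - 1)^-1 by rewrite invr_gt0 subr_gt0.
set c := (p - 1)^-1 in c0 *.
pose f x := h x * Num.max (r x - 1) 0.
pose f1 x := h x * Num.max (r1 x - 1) 0.
pose f2 x := h x * Num.max (r2 x - 1) 0.
pose g x := s * f1 x + (1 - s) * f2 x.
have f_ge0 u x : 0 <= h x * Num.max (u x - 1) 0.
  by rewrite mulr_ge0 // le_max lexx orbT.
have mf : measurable_fun setT f by exact: excessM.
have mf1 : measurable_fun setT f1 by exact: excessM.
have mf2 : measurable_fun setT f2 by exact: excessM.
have mg : measurable_fun setT g.
  by apply: measurable_funD; apply: measurable_funM.
have gE x : g x = h x * (s * Num.max (r1 x - 1) 0 + (1 - s) * Num.max (r2 x - 1) 0).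
  by rewrite /g /f1 /f2; ring.
have fg x : f x <= g x.
  by rewrite gE ler_wpM2l // maxr_sub1_convex.
have If : (\int[m]_x (f x)%:E = c%:E * superlevel_mass m h r 1)%E.
  exact: integral_excess.
(* By the layer cake formula the integral of [g] is [c] times a weighted average of two masses, each
   at most 1. *)
have Ig : (\int[m]_x (g x)%:E <= c%:E)%E.
  have -> : (\int[m]_x (g x)%:E = s%:E * (c%:E * superlevel_mass m h r1 1) +
     (1 - s)%:E * (c%:E * superlevel_mass m h r2 1))%E.
    have Z (t : R) (u : T -> R) : 0 <= t -> (forall x, 0 <= u x) ->
        measurable_fun setT u ->
        (\int[m]_x (t * u x)%:E = t%:E * \int[m]_x (u x)%:E)%E.
      move=> t0 u0 mu; rewrite -ge0_integralZl_EFin //.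
      - by move=> x _; rewrite lee_fin.
      - exact/measurable_EFinP.
    have s1' : 0 <= 1 - s by rewrite subr_ge0 ltW.
    rewrite -!integral_excess // -[X in (X + _)%E]Z ?ltW// -[X in (_ + X)%E]Z //.
    rewrite -ge0_integralD //.
    - by move=> x _; rewrite lee_fin mulr_ge0 ?f_ge0 ?(ltW s0).
    - by apply/measurable_EFinP; apply: measurable_funM.
    - by move=> x _; rewrite lee_fin mulr_ge0 ?f_ge0.
    - by apply/measurable_EFinP; apply: measurable_funM.
  have bnd (t : R) W : 0 <= t -> (W <= 1)%E -> (t%:E * (c%:E * W) <= (t * c)%:E)%E.
    move=> t0 W_1; rewrite EFinM lee_wpmul2l ?lee_fin //.
    by rewrite -[leRHS]mule1 lee_wpmul2l // lee_fin ltW.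
  have s1' : 0 <= 1 - s by rewrite subr_ge0 ltW.
  apply: le_trans (leeD (bnd _ _ (ltW s0) W1) (bnd _ _ s1' W2)) _.
  by rewrite -EFinD lee_fin -mulrDl addrC subrK mul1r.
have If_le : (\int[m]_x (f x)%:E <= \int[m]_x (g x)%:E)%E.
  apply: ge0_le_integral => // [x _|||x _]; rewrite ?lee_fin ?f_ge0 ?fg //;
    exact/measurable_EFinP.
split.
  have := le_trans If_le Ig; rewrite If -[leRHS]mule1.
  by rewrite lee_pmul2l.
move=> W; move: If; rewrite W mule1 => If.
have gf0 x : 0 <= g x - f x by rewrite subr_ge0.
have mgf : measurable_fun setT (fun x => g x - f x).
  exact: measurable_funB.
(* The integral of [f] equals the finite number [c], so it cancels when the integral of [g], at most
   [c], is split into those of [f] and [g - f]. *)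
have Igf0 : (\int[m]_x (g x - f x)%:E = 0)%E.
  have E : (\int[m]_x (g x)%:E = c%:E + \int[m]_x (g x - f x)%:E)%E.
    rewrite -If -ge0_integralD //.
    - by apply: eq_integral => x _; rewrite -EFinD addrC subrK.
    - by move=> x _; rewrite lee_fin f_ge0.
    - by apply/measurable_EFinP.
    - by move=> x _; rewrite lee_fin.
    - by apply/measurable_EFinP.
  apply/eqP; rewrite eq_le; apply/andP; split; last first.
    by apply: integral_ge0 => x _; rewrite lee_fin.
  by move: Ig; rewrite E -[leRHS]adde0 leeD2lE.
have N0 := integral_eq0_support gf0 mgf Igf0.
apply: (subset_measure0 _ _ _ N0).
- exact: crossing_measurable.
- rewrite -[X in measurable X]setTI.
  exact: (measurable_fun_ltr (@measurable_cst _ _ _ _ _ (0 : R)) mgf).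
move=> x [hx r1x r2x] /=; rewrite gE /f -mulrBr mulr_gt0 // subr_gt0.
exact: maxr_sub1_convex_strict.
Qed.

End convex_mass.

Section minkowski_inequality.
Variables (R : realType) (d : measure_display) (T : measurableType d).
Variables (m : {sigma_finite_measure set T -> \bar R}) (h : T -> R).
Hypotheses (h0 : forall x, 0 <= h x) (mh : measurable_fun setT h).

Let superlevel_mass_normalized (p v : R) (r : T -> R) : 0 < p -> 0 < v ->
  homogeneous_mass m h p r -> superlevel_mass m h r 1 = v%:E ->
  superlevel_mass m h (fun x => r x / v `^ p^-1) 1 = 1%E.
Proof.
move=> p0 v0 hr Wr.
have a0 : 0 < v `^ p^-1 by rewrite powR_gt0.
rewrite superlevel_mass_div // mul1r hr // Wr -EFinM -powRrM.
by rewrite mulrN mulVf ?gt_eqF // powR_inv1 ?ltW // mulVf ?gt_eqF.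
Qed.

Lemma minkowski_mass (p v1 v2 : R) (r1 r2 : T -> R)
    (a := v1 `^ p^-1) (b := v2 `^ p^-1) (r := fun x => r1 x + r2 x) :
  1 < p -> 0 < v1 -> 0 < v2 -> measurable_fun setT r1 -> measurable_fun setT r2 ->
  homogeneous_mass m h p r1 -> homogeneous_mass m h p r2 ->
  homogeneous_mass m h p r ->
  superlevel_mass m h r1 1 = v1%:E -> superlevel_mass m h r2 1 = v2%:E ->
  (superlevel_mass m h r 1 <= ((a + b) `^ p)%:E)%E /\
  (superlevel_mass m h r 1 = ((a + b) `^ p)%:E ->
   m [set x | [/\ 0 < h x, a < r1 x & r2 x < b]] = 0%E).
Proof.
move=> p1 v10 v20 mr1 mr2 hr1 hr2 hr W1 W2.
have p0 : 0 < p by exact: lt_trans p1.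
have a0 : 0 < a by rewrite powR_gt0.
have b0 : 0 < b by rewrite powR_gt0.
have ab0 : 0 < a + b by rewrite addr_gt0.
(* With this weight the convex combination of [r1 / a] and [r2 / b], both of mass 1, is exactly
   [(r1 + r2) / (a + b)]. *)
pose s := a / (a + b).
have s01 : 0 < s < 1 by rewrite divr_gt0 //= ltr_pdivrMr // mul1r ltrDl.
have rE : (fun x => s * (r1 x / a) + (1 - s) * (r2 x / b)) = (fun x => r x / (a + b)).
  apply/funext => x; rewrite /s /r; field.
  by rewrite !gt_eqF.
have mdiv (u : T -> R) (c : R) : measurable_fun setT u ->
    measurable_fun setT (fun x : T => u x / c).
  by move=> mu; apply: measurable_funM.
have [] := @convex_mass _ _ _ m h h0 mh p s (fun x => r1 x / a) (fun x => r2 x / b) p1 s01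
  (mdiv _ _ mr1) (mdiv _ _ mr2) (homogeneous_mass_div a0 hr1) (homogeneous_mass_div b0 hr2).
- by rewrite rE; exact: homogeneous_mass_div.
- by rewrite (superlevel_mass_normalized p0 v10 hr1 W1).
- by rewrite (superlevel_mass_normalized p0 v20 hr2 W2).
rewrite rE superlevel_mass_div // mul1r hr //.
have cn0 : 0 < (a + b) `^ (- p) by rewrite powR_gt0.
have cK : ((a + b) `^ p)%:E = (((a + b) `^ (- p))^-1)%:E :> \bar R.
  by rewrite powRN invrK.
move=> le1 eq1; split.
  by rewrite cK -[leRHS]mule1 lee_pdivlMl.
move=> E; rewrite -[RHS]eq1; last first.
  by rewrite E -EFinM powRN mulVf // gt_eqF // powR_gt0.
congr (m _); apply/seteqP; split => x /= [hx];
  rewrite ?ltr_pdivlMr ?ltr_pdivrMr // ?mul1r; by split.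
Qed.

Lemma subadditive_mass (v1 v2 : R) (r1 r2 : T -> R) (r := fun x => r1 x + r2 x) :
  measurable_fun setT r1 -> measurable_fun setT r2 ->
  homogeneous_mass m h 1 r1 -> homogeneous_mass m h 1 r2 ->
  homogeneous_mass m h 1 r ->
  superlevel_mass m h r1 1 = v1%:E -> superlevel_mass m h r2 1 = v2%:E ->
  (superlevel_mass m h r 1 <= (v1 + v2)%:E)%E.
Proof.
move=> mr1 mr2 hr1 hr2 hr W1 W2.
have mr : measurable_fun setT r by exact: measurable_funD.
(* [K a b x] is the length of the part of []a, b[] below [x]. *)
pose K (a b x : R) := Num.max (Num.min b x - a) 0.
have K0 a b x : 0 <= K a b x by rewrite le_max lexx orbT.
have mK a b u : measurable_fun setT u -> measurable_fun setT (fun x => h x * K a b (u x)).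
  move=> mu; apply: measurable_funM => //.
  apply: measurable_maxr => //; apply: measurable_funB => //.
  exact: measurable_minr.
have IK (a b : R) u : 0 < a -> a < b -> measurable_fun setT u -> homogeneous_mass m h 1 u ->
    (\int[m]_x (h x * K a b (u x))%:E = (ln b - ln a)%:E * superlevel_mass m h u 1)%E.
  move=> a0 ab mu hu; rewrite -integral_powRN1_itv // -layer_cake //.
    by apply: eq_integral => x _; rewrite EFinM lebesgue_measure_itvI_lt2.
  by move=> t /=; rewrite in_itv /= => /andP[at_ _]; exact: lt_trans at_.
(* The threshold 2 on the left pays for the two thresholds 1 on the right when neither [x] nor [y]
   exceeds [b]; otherwise one right-hand term is at least [b - 1], which already suffices. *)
have Kle b x y : K 2 b (x + y) <= K 1 b x + K 1 b y.
  have Kge z : Num.min b z - 1 <= K 1 b z by rewrite le_max lexx.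
  rewrite {1}/K ge_max.
  have := Kge x; have := Kge y; have := K0 1 b x; have := K0 1 b y.
  have : Num.min b (x + y) <= b by rewrite ge_min lexx.
  have : Num.min b (x + y) <= x + y by rewrite ge_min lexx orbT.
  by case: (leP b x) => ?; case: (leP b y) => ? *; apply/andP; split; lra.
have key (b : R) : 2 < b ->
    ((ln b - ln 2)%:E * superlevel_mass m h r 1 <= (ln b * (v1 + v2))%R%:E)%E.
  move=> b2; have b1 : 1 < b by apply: lt_trans b2; lra.
  rewrite -IK //.
  have -> : (ln b * (v1 + v2))%:E =
      (\int[m]_x (h x * K 1 b (r1 x) + h x * K 1 b (r2 x))%:E)%E.
    under eq_integral do rewrite EFinD.
    rewrite ge0_integralD //.
    - by rewrite !IK // W1 W2 ln1 subr0 -!EFinM -EFinD mulrDr.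
    - by move=> x _; rewrite lee_fin mulr_ge0.
    - by apply/measurable_EFinP; exact: mK.
    - by move=> x _; rewrite lee_fin mulr_ge0.
    - by apply/measurable_EFinP; exact: mK.
  apply: ge0_le_integral => // [x _|||x _]; rewrite ?lee_fin.
  - by rewrite mulr_ge0.
  - by apply/measurable_EFinP; exact: mK.
  - by apply/measurable_EFinP; apply: measurable_funD; exact: mK.
  - by rewrite -mulrDr ler_wpM2l //; exact: Kle.
have mass_ge0 u : (0 <= superlevel_mass m h u 1)%E.
  by apply: integral_ge0 => x _; rewrite lee_fin; case: ifP.
have v1_ge0 : 0 <= v1 by rewrite -lee_fin -W1.
have v2_ge0 : 0 <= v2 by rewrite -lee_fin -W2.
have W0 := mass_ge0 r.
have ln20 : 0 < ln (2 : R) by rewrite ln_gt0 //; lra.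
(* An infinite mass already contradicts [key] at [b = 4]. *)
move: W0 key; case: (superlevel_mass m h r 1) => [v|/=|//]; last first.
  move=> _ /(_ 4); rewrite mulry gtr0_sg ?mul1e; last first.
    by rewrite subr_gt0 ltr_ln ?posrE; lra.
  by move=> /(_ _); rewrite leye_eq => /(_ ltac:(lra)).
rewrite !lee_fin => v0 key; rewrite leNgt; apply/negP => vlt.
set w := v1 + v2 in vlt key.
have vw : 0 < v - w by rewrite subr_gt0.
(* Chosen so that [(L - ln 2) * v - L * w = ln 2 * (v - w)], which is positive; hence [b = expR L]
   contradicts [key] and stands in for the limit. *)
pose L := ln 2 * v / (v - w) + ln 2.
have L2 : ln 2 < L.
  by rewrite /L ltrDr divr_gt0 // mulr_gt0 // (le_lt_trans _ vlt) // addr_ge0.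
have := key (expR L); rewrite -EFinM lee_fin expRK => H.
have {}H : (L - ln 2) * v <= L * w.
  apply: H; have -> : (2 : R) = expR (ln 2) by rewrite lnK // posrE ltr0n.
  by rewrite ltr_expR.
have LE : L * (v - w) = ln 2 * v + ln 2 * (v - w).
  by rewrite /L mulrDl divfK // gt_eqF.
have := mulr_gt0 ln20 vw; lra.
Qed.

End minkowski_inequality.

(** * Measurability of sets pulled back from R^n, and monotonicity of iterated integrals *)

Lemma rat_box_sub (R : realType) n (U : set 'rV[R]_n) (x : 'rV[R]_n) :
  open U -> U x -> exists (c : 'rV[rat]_n) (k : nat),
    (forall i, `|x 0 i - ratr (c 0 i)| < k.+1%:R^-1) /\
    [set v : 'rV[R]_n | forall i, `|v 0 i - ratr (c 0 i)| < k.+1%:R^-1] `<=` U.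
Proof.
move=> oU Ux.
have /nbhs_ballP[e /= e0 eU] : nbhs x U by exact: open_nbhs_nbhs.
(* Twice the box radius must stay below [e], since both [x] and [v] are only known to be within one
   radius of the rational centre. *)
pose k := Num.truncn (2 / e).
have ke : k.+1%:R^-1 + k.+1%:R^-1 < e.
  have : 2 / e < k.+1%:R.
    have /truncn_itv/andP[_] : 0 <= 2 / e by rewrite divr_ge0 // ltW.
    exact.
  rewrite ltr_pdivrMr // => k2.
  have : 2 / k.+1%:R < e by rewrite ltr_pdivrMr // mulrC.
  by rewrite mulr_natl mulr2n.
have k0 : 0 < k.+1%:R^-1 :> R by rewrite invr_gt0.
have /choice[c Hc] : forall i : 'I_n, exists q : rat, `|x 0 i - ratr q| < k.+1%:R^-1.
  move=> i.
  have /rat_in_itvoo[q] : x 0 i - k.+1%:R^-1 < x 0 i + k.+1%:R^-1.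
    by rewrite ltrD2l; apply: lt_trans k0; rewrite oppr_lt0.
  by rewrite in_itv /= => /andP[q1 q2]; exists q; rewrite distrC ltr_distl q1.
exists (\row_i c i), k; split=> [i|v /= Hv]; first by rewrite mxE.
apply: eU; split => // i j; rewrite (ord1 i) /ball /=.
have := Hv j; have := Hc j; rewrite mxE => H1 H2.
apply: le_lt_trans ke; rewrite -(subrK (ratr (c j)) (x 0 j)) -addrA.
apply: (le_trans (ler_normD _ _)); apply: lerD; first exact: ltW.
by rewrite distrC ltW.
Qed.

(* No measurability is assumed: it is applied to the Minkowski sum, whose
   closedness is never established. *)
Lemma le_integral_pointwise d (T : measurableType d) (R : realType)
    (m : {measure set T -> \bar R}) (f g : T -> \bar R) :
  (forall x, (f x <= g x)%E) -> (\int[m]_x f x <= \int[m]_x g x)%E.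
Proof.
move=> fg.
(* For nonnegative functions the integral is a supremum over simple functions lying below, and this
   family grows with the function. *)
have mono (u v : T -> \bar R) : (forall x, 0 <= u x)%E -> (forall x, u x <= v x)%E ->
    (\int[m]_x u x <= \int[m]_x v x)%E.
  move=> u0 uv; have v0 x : (0 <= v x)%E by exact: le_trans (uv x).
  rewrite !ge0_integralTE //; apply: le_ereal_sup => _ [k /= ku <-].
  by exists k => // x; exact: le_trans (uv x).
rewrite integralE [leRHS]integralE; apply: leeB.
- apply: mono => x; first by rewrite funeposE le_max lexx orbT.
  by rewrite !funeposE ge_max !le_max fg lexx orbT.
- apply: mono => x; first by rewrite funenegE le_max lexx orbT.
  by rewrite !funenegE ge_max !le_max leeN2 fg lexx orbT.
Qed.

Lemma lebesgue_int_rV_le (R : realType) n (f g : 'rV[R]_n -> \bar R) :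
  (forall v, (f v <= g v)%E) -> (lebesgue_int_rV f <= lebesgue_int_rV g)%E.
Proof.
elim: n f g => [|n IH] f g fg /=; first exact: fg.
by apply: le_integral_pointwise => t; apply: IH => v.
Qed.

Lemma lebesgue_int_rV_ge0 (R : realType) n (f : 'rV[R]_n -> \bar R) :
  (forall v, 0 <= f v)%E -> (0 <= lebesgue_int_rV f)%E.
Proof.
elim: n f => [|n IH] f f0 /=; first exact: f0.
by apply: integral_ge0 => t _; apply: IH => v.
Qed.

(** The sign of [Theta 0] is unknown, hence so is that of a covolume integrand at the origin; but
    the origin lies in the null slice [t = 0]. *)
Lemma lebesgue_int_rV_ge0_off0 (R : realType) n (f : 'rV[R]_n -> \bar R) :
  (0 < n)%N -> (forall v, v != 0 -> (0 <= f v)%E) -> (0 <= lebesgue_int_rV f)%E.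
Proof.
case: n f => // n f _ f0 /=.
set F := (X in integral _ _ X).
have F0 t : t != 0 -> (0 <= F t)%E.
  move=> t0; apply: lebesgue_int_rV_ge0 => y; apply: f0.
  apply: contra t0 => /eqP/matrixP /(_ 0 (lshift n (ord0 : 'I_1))).
  move=> E; apply/eqP; move: E; rewrite [RHS]mxE => <-.
  by apply/esym/(etrans (row_mxEl _ _ 0 ord0)); rewrite mxE.
(* [G] keeps only the slice through the origin, so it integrates to 0 while staying below [F]. *)
pose G t := if t == 0 :> R then F 0 else 0%E.
have <- : (\int[@lebesgue_measure R]_t G t = 0)%E.
  rewrite -(integral0 (@lebesgue_measure R) setT); apply: ae_eq_integral => //.
    apply: measurable_fun_ifT => //.
    by apply: measurable_fun_eqr.
  exists [set 0]; split=> //; first exact: lebesgue_measure_set1.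
  move=> t /= h; apply/eqP; apply: contrapT => /negP /negPf E; apply: h.
  by rewrite /G E.
apply: le_integral_pointwise => t; rewrite /G; case: eqVneq => [->//|]; exact: F0.
Qed.

Section rV_model_theory.
Variables (R : realType) (n : nat) (d : measure_display) (T : measurableType d).
Variables (m : {sigma_finite_measure set T -> \bar R}) (phi : T -> 'rV[R]_n).
Variable (sc : R -> T -> T).
Hypothesis H : rV_model m phi sc.

(** An open set is the union of the boxes inside it with rational centre and radius [k.+1%:R^-1], a
    countable family. *)
Lemma rV_openM (U : set 'rV[R]_n) : open U -> measurable (phi @^-1` U).
Proof.
move=> oU.
pose B (ck : 'rV[rat]_n * nat) : set 'rV[R]_n :=
  [set v : 'rV[R]_n | forall i, `|v 0 i - ratr (ck.1 0 i)| < ck.2.+1%:R^-1].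
pose F ck : set T := if `[< B ck `<=` U >] then phi @^-1` B ck else set0.
have -> : phi @^-1` U = \bigcup_ck F ck.
  apply/seteqP; split => x /=.
    move=> Ux; have [c [k [Hx HU]]] := rat_box_sub oU Ux.
    by exists (c, k) => //; rewrite /F; case: asboolP.
  by move=> [ck _]; rewrite /F; case: asboolP => // + Bx; apply.
apply: countable_bigcupT_measurable => // ck; rewrite /F; case: ifP => // _.
have := rV_boxM (phi := phi) (\row_i ratr (ck.1 0 i)) (ck.2.+1%:R^-1) (rV_coordM H).
congr measurable; apply/seteqP; split => x /= h i; have := h i; by rewrite mxE.
Qed.

Lemma rV_closedM (A : set 'rV[R]_n) : closed A -> measurable (phi @^-1` A).
Proof.
move=> /closed_openC/rV_openM; rewrite preimage_setC => /measurableC.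
by rewrite setCK.
Qed.

Lemma rV_withinM (A : set 'rV[R]_n) (f : 'rV[R]_n -> R) :
  measurable (phi @^-1` A) -> {within A, continuous f} ->
  measurable_fun setT (fun x => if phi x \in A then f (phi x) else 0).
Proof.
move=> mA cf.
have mAb : measurable_fun setT (fun x => phi x \in A).
  apply: (measurable_fun_bool true); rewrite setTI.
  rewrite (_ : _ @^-1` _ = phi @^-1` A) //.
  by apply/seteqP; split => x /=; [move/set_mem|move/mem_set].
apply: measurable_fun_if => //.
rewrite setTI (_ : _ @^-1` _ = phi @^-1` A); last first.
  by apply/seteqP; split => x /=; [move/set_mem|move/mem_set].
apply: (measurability _ (RGenOpens.measurableE R)).
move=> _ [_ [a [b ->] <-]].
have oab : open `]a, b[%classic by exact: interval_open.
(* Continuity within [A] makes the preimage of an interval the trace on [A] of an open set [V]. *)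
have /open_subspaceP[V oV VE] := (continuousP _).1 cf _ oab.
rewrite (_ : _ `&` _ = phi @^-1` (V `&` A)).
  by rewrite preimage_setI; apply: measurableI => //; exact: rV_openM.
by rewrite VE; apply/seteqP; split => x [].
Qed.

(** Forces open null sets to be empty, which turns almost-everywhere information into pointwise
    inclusions. *)
Lemma rV_open_gt0 (U : set 'rV[R]_n) : open U -> U !=set0 ->
  (0 < m (phi @^-1` U))%E.
Proof.
move=> oU [v Uv]; have /nbhs_ballP[e /= e0 eU] : nbhs v U by exact: open_nbhs_nbhs.
apply: (lt_le_trans (rV_box_pos H v e0)); apply: le_measure; rewrite ?inE.
- by apply: rV_boxM; exact: rV_coordM H.
- exact: rV_openM.
- by move=> x /= h; apply: eU; split => // i j; rewrite (ord1 i) /ball /= distrC.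
Qed.

End rV_model_theory.

(** * Pseudo-cones and radial functions *)

Lemma closed_ray (R : realType) n (E : set 'rV[R]_n) (u w : 'rV[R]_n) :
  closed E -> (forall s, 0 < s <= 1 -> E (u + s *: w)) -> E u.
Proof.
move=> cE Es.
have cv : u + s *: w @[s --> (0 : R)^'+] --> u.
  rewrite -[X in _ --> X]addr0 -(scale0r w); apply: cvg_at_right_filter.
  by apply: cvgD; [exact: cvg_cst|by apply: cvgZr_tmp; exact: cvg_id].
apply: (closed_cvg E cE _ _ cv).
near=> s; apply: Es; apply/andP; split; first by near: s; exact: nbhs_right_gt.
by near: s; exact: nbhs_right_le.
Unshelve. all: by end_near. Qed.

Section pseudo_cone_theory.
Variables (R : realType) (n : nat) (C E : set 'rV[R]_n).
Hypotheses (HC : pointed_cone C) (HE : pseudo_cone C E).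

Lemma pseudo_cone_closed : closed E. Proof. by case: HE => _ []. Qed.

Lemma pseudo_cone_convex : Defs.convex_set E. Proof. by case: HE => _ [_ []]. Qed.

Lemma pseudo_cone_not0 : ~ E 0. Proof. by case: HE => _ [_ [_ []]]. Qed.

Lemma pseudo_coneZ x l : E x -> 1 <= l -> E (l *: x).
Proof. by case: HE => _ [_ [_ [_ [H _]]]]; exact: H. Qed.

Lemma pseudo_coneD x y : E x -> C y -> E (x + y).
Proof.
by case: HE => _ [_ [_ [_ [_ CE]]]] Ex; rewrite -{1}CE => H; exact: H.
Qed.

Lemma pseudo_cone_sub x : E x -> C x.
Proof.
move=> Ex; have [_ [_ [_ [_ [_ <-]]]]] := HE => y Ey.
(* [y + x] is the limit, as [s] tends to 0, of the convex combinations of [s^-1 *: x] and [y] with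
   weight [s]; so [x] is a recession direction of [E]. *)
apply: (closed_ray (w := - y) pseudo_cone_closed) => s /andP[s0 s1].
have -> : y + x + s *: - y = s *: (s^-1 *: x) + (1 - s) *: y.
  by rewrite scalerA mulfV ?gt_eqF // scale1r scalerBl scale1r scalerN addrA [x + y]addrC.
apply: pseudo_cone_convex => //; last by rewrite ltW.
by apply: pseudo_coneZ => //; rewrite invf_ge1.
Qed.

Definition reach v := exists r : R, 0 < r /\ E (r *: v).

(** The function rho_E. The default 0 on rays missing [E], in place of infinity, keeps it
    real-valued; for close sets those rays carry no mass. *)
Definition radial (v : 'rV[R]_n) : R :=
  if `[< reach v >] then inf [set r : R | 0 < r /\ E (r *: v)] else 0.

Lemma reachZ l v : 0 < l -> reach (l *: v) <-> reach v.
Proof.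
move=> l0; split=> [[r [r0 Er]]|[r [r0 Er]]].
  by exists (r * l); rewrite mulr_gt0 // -scalerA.
by exists (r / l); rewrite divr_gt0 // scalerA divfK ?gt_eqF.
Qed.

Lemma reach_cone v : reach v -> C v.
Proof.
move=> [r [r0 /pseudo_cone_sub Cr]]; have [_ _ sc _ _] := HC.
have := sc _ r^-1 Cr; rewrite scalerA mulVf ?gt_eqF // scale1r; apply.
by rewrite invr_ge0 ltW.
Qed.

Lemma reach_neq0 v : reach v -> v != 0.
Proof.
move=> [r [_ Er]]; apply/eqP => v0; apply: pseudo_cone_not0.
by move: Er; rewrite v0 scaler0.
Qed.

Lemma pseudo_cone_up v s t : 0 < s -> s <= t -> E (s *: v) -> E (t *: v).
Proof.
move=> s0 st Es; have -> : t *: v = (t / s) *: (s *: v).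
  by rewrite scalerA divfK ?gt_eqF.
by apply: pseudo_coneZ => //; rewrite ler_pdivlMr // mul1r.
Qed.

Let infE v : reach v -> radial v = inf [set r : R | 0 < r /\ E (r *: v)].
Proof. by rewrite /radial; case: asboolP. Qed.

Lemma radial_ge0 v : 0 <= radial v.
Proof.
rewrite /radial; case: asboolP => // -[r [r0 Er]].
by apply: lb_le_inf; [exists r|move=> x [x0 _]; exact: ltW].
Qed.

(** Closedness of [E] makes the infimum attained, and stability under dilations of ratio at least 1
    makes the set of admissible factors an up-set. *)
Lemma radial_le v t : reach v -> 0 < t -> radial v <= t <-> E (t *: v).
Proof.
move=> rv t0; have hi : has_inf [set r : R | 0 < r /\ E (r *: v)].
  split; first by case: rv => r Hr; exists r.
  by exists 0 => x [x0 _]; exact: ltW.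
rewrite infE //; split=> [le_t|Et]; last by apply: ge_inf; [case: hi|].
apply: (closed_ray (w := v) pseudo_cone_closed) => s /andP[s0 _].
rewrite -scalerDl.
have [r /= [r0 Er] r_lt] := inf_adherent s0 hi.
apply: (pseudo_cone_up r0 _ Er).
by apply: ltW; apply: lt_le_trans r_lt _; rewrite lerD2r.
Qed.

Lemma radial_gt0 v : reach v -> 0 < radial v.
Proof.
move=> rv; rewrite lt_def radial_ge0 andbT; apply/eqP => r0.
apply: pseudo_cone_not0; apply: (closed_ray (w := v) pseudo_cone_closed).
move=> s /andP[s0 _]; rewrite add0r.
by apply/(radial_le rv s0); rewrite r0 ltW.
Qed.

Lemma radialZ l v : 0 < l -> radial (l *: v) = radial v / l.
Proof.
move=> l0; case: (pselect (reach v)) => [rv|nrv]; last first.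
  rewrite /radial !asboolF ?mul0r //.
  by move/(reachZ _ l0).
have rlv := (reachZ v l0).2 rv.
have key t : 0 < t -> (radial (l *: v) <= t) = (radial v / l <= t).
  move=> t0; rewrite ler_pdivrMr //.
  apply/idP/idP.
    move/(radial_le rlv t0); rewrite scalerA => Et.
    by apply/(radial_le rv (mulr_gt0 t0 l0)).
  move/(radial_le rv (mulr_gt0 t0 l0)); rewrite -scalerA => Et.
  by apply/(radial_le rlv t0).
apply/eqP; rewrite eq_le; apply/andP; split.
  by rewrite key // divr_gt0 // radial_gt0.
by rewrite -key // radial_gt0.
Qed.

(** For [e] in [E] and small [s > 0], [v - s *: e] stays in [C]; adding [s^-1] times it to [e] gives
    [s^-1 *: v], which is thus in [E]. *)
Lemma interior_reach v : interior C v -> reach v.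
Proof.
move=> iv; have [[e Ee] _] := HE.
have nb : \forall s \near (0 : R)^'+, C (v - s *: e).
  have cv : v - s *: e @[s --> (0 : R)^'+] --> v.
    rewrite -[X in _ --> X]subr0 -(scale0r e); apply: cvg_at_right_filter.
    by apply: cvgB; [exact: cvg_cst|by apply: cvgZr_tmp; exact: cvg_id].
  exact: (cv _ iv).
have [s [s0 Cs]] : exists s : R, 0 < s /\ C (v - s *: e).
  near (0 : R)^'+ => s; exists s; split; first by near: s; exact: nbhs_right_gt.
  by near: s.
exists s^-1; split; first by rewrite invr_gt0.
have -> : s^-1 *: v = e + s^-1 *: (v - s *: e).
  by rewrite scalerBr scalerA mulVf ?gt_eqF // scale1r addrC subrK.
apply: pseudo_coneD => //; have [_ _ sc _ _] := HC.
by apply: sc => //; rewrite invr_ge0 ltW.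
Unshelve. all: by end_near. Qed.

End pseudo_cone_theory.

(** The bound rho_{E1+E2} <= rho_{E1} + rho_{E2} at level 1. Moving [v] to the boundaries of [E1]
    and [E2] and dilating both points by the inverse of the sum, which is at least 1, splits [v]. *)
Lemma radial_sum (R : realType) n (C E1 E2 : set 'rV[R]_n) v :
  pseudo_cone C E1 -> pseudo_cone C E2 -> reach E1 v -> reach E2 v ->
  radial E1 v + radial E2 v <= 1 -> minkowski_sum E1 E2 v.
Proof.
move=> H1 H2 v1 v2 le1.
have p1 := radial_gt0 H1 v1; have p2 := radial_gt0 H2 v2.
have s0 : 0 < radial E1 v + radial E2 v by rewrite addr_gt0.
have s1 : 1 <= (radial E1 v + radial E2 v)^-1 by rewrite invf_ge1.
exists ((radial E1 v + radial E2 v)^-1 *: (radial E1 v *: v)).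
exists ((radial E1 v + radial E2 v)^-1 *: (radial E2 v *: v)).
split; first by apply: (pseudo_coneZ H1) => //; apply/(radial_le H1 v1 p1).
split; first by apply: (pseudo_coneZ H2) => //; apply/(radial_le H2 v2 p2).
by rewrite -scalerDr -scalerDl scalerA mulVf ?gt_eqF // scale1r.
Qed.

(** By convexity [x + l *: y] is [1 + l] times a convex combination of [x] and [y]. *)
Lemma minkowski_sum_dilate (R : realType) n (E : set 'rV[R]_n) (l : R) :
  Defs.convex_set E -> 0 < l ->
  minkowski_sum E (dilate l E) = dilate (1 + l) E.
Proof.
move=> cE l0; have l1 : 0 < 1 + l by rewrite addr_gt0.
apply/seteqP; split => [z [x [_ [Ex [[y Ey <-] ->]]]]|_ [z Ez <-]]; last first.
  by exists z, (l *: z); split => //; split; [exists z|rewrite scalerDl scale1r].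
exists ((1 + l)^-1 *: x + (1 - (1 + l)^-1) *: y).
  apply: cE => //; rewrite invr_ge0 (ltW l1) invf_le1 // lerDl ltW //.
rewrite scalerDr !scalerA mulfV ?gt_eqF // scale1r mulrBr mulr1 mulfV ?gt_eqF //.
by rewrite addrAC subrr add0r.
Qed.

(** * Weighted covolumes *)

Section cone_mass.
Variables (R : realType) (n : nat) (C : set 'rV[R]_n) (q : R).
Variable Theta : 'rV[R]_n -> R.
Hypotheses (n2 : (2 <= n)%N) (HC : pointed_cone C).
Hypotheses (qn : q <= n%:R - 1) (cT : {within C `\ 0, continuous Theta}).
Hypothesis T_gt0 : forall x, C x -> x != 0 -> 0 < Theta x.
Hypothesis TZ : forall x (t : R), C x -> x != 0 -> 0 < t ->
  Theta (t *: x) = t `^ (- q) * Theta x.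
Variables (d : measure_display) (T : measurableType d).
Variables (m : {sigma_finite_measure set T -> \bar R}) (phi : T -> 'rV[R]_n).
Variable sc : R -> T -> T.
Hypothesis H : rV_model m phi sc.

Let p := n%:R - q.

Let p1 : 1 <= p. Proof. by rewrite /p lerBrDr addrC -lerBrDr. Qed.

(* Theta is only constrained away from 0, so it is cut off at the origin. *)
Definition density v : R := if v \in C `\ 0 then Theta v else 0.

Lemma densityE v : C v -> v != 0 -> density v = Theta v.
Proof.
move=> Cv v0; rewrite /density ifT //; apply/mem_set; split => //=.
by apply/eqP.
Qed.

Lemma density_ge0 v : 0 <= density v.
Proof.
rewrite /density; case: ifP => // /set_mem[Cv /= /eqP v0].
by rewrite ltW // T_gt0.
Qed.

Lemma densityM : measurable_fun setT (density \o phi).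
Proof.
apply: (rV_withinM H (A := C `\ 0)) => //.
apply: (@measurableD _ _ (phi @^-1` C) (phi @^-1` [set 0])).
  by apply: (rV_closedM H); case: HC.
by apply: (rV_closedM H); apply: accessible_closed_set1;
  apply: hausdorff_accessible; exact: norm_hausdorff.
Qed.

Lemma densityZ v (l : R) : 0 < l -> density (l *: v) = l `^ (- q) * density v.
Proof.
move=> l0; have [_ _ scC _ _] := HC.
rewrite /density; case: ifPn => [/set_mem[Clv /= /eqP lv0]|].
  have v0 : v != 0 by apply: contra lv0 => /eqP ->; rewrite scaler0.
  have Cv : C v.
    have := scC _ l^-1 Clv; rewrite scalerA mulVf ?gt_eqF // scale1r; apply.
    by rewrite invr_ge0 ltW.
  by rewrite ifT ?TZ //; apply/mem_set; split => //=; apply/eqP.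
move=> nlv; rewrite ifN ?mulr0 //; apply: contra nlv => /set_mem[Cv /= /eqP v0].
apply/mem_set; split => /=; first by apply: scC => //; exact: ltW.
by apply/eqP; rewrite scaler_eq0 negb_or gt_eqF.
Qed.

Definition mass (P : 'rV[R]_n -> bool) : \bar R :=
  (\int[m]_x (if P (phi x) then density (phi x) else 0)%:E)%E.

Lemma mass_integrandM (P : 'rV[R]_n -> bool) : measurable_fun setT (P \o phi) ->
  measurable_fun setT (fun x => (if P (phi x) then density (phi x) else 0)%:E).
Proof.
move=> mP; apply/measurable_EFinP; apply: measurable_fun_ifT => //.
exact: densityM.
Qed.

Lemma mass_integrand_ge0 (P : 'rV[R]_n -> bool) v :
  (0 <= (if P v then density v else 0)%:E)%E.
Proof. by rewrite lee_fin; case: ifP => // _; exact: density_ge0. Qed.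

Lemma mass_ge0 P : (0 <= mass P)%E.
Proof. by apply: integral_ge0 => x _; exact: mass_integrand_ge0. Qed.

Lemma le_mass (P Q : 'rV[R]_n -> bool) : (forall v, P v -> Q v) ->
  (mass P <= mass Q)%E.
Proof.
move=> PQ; apply: le_integral_pointwise => x; rewrite lee_fin.
case: ifP => [/PQ ->//|_]; case: ifP => // _; exact: density_ge0.
Qed.

Lemma massZ (P : 'rV[R]_n -> bool) (l : R) : 0 < l ->
  measurable_fun setT (P \o phi) ->
  mass (fun v => P (l *: v)) = ((l `^ (- p))%:E * mass P)%E.
Proof.
move=> l0 mP.
have := rV_sc_int H l0 (fun x => mass_integrand_ge0 P (phi x)) (mass_integrandM mP).
under eq_integral do rewrite (rV_scE H).
rewrite -/(mass P) => E.
have -> : (l `^ (- p))%:E = ((l `^ q)%:E * (l^-1 ^+ n)%:E)%E.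
  rewrite -EFinM /p opprB powRD; last by rewrite (gt_eqF l0) implybT.
  by rewrite exprVn -powR_mulrn ?(ltW l0) // powRN.
rewrite -muleA -E -ge0_integralZl //.
- apply: eq_integral => x _; rewrite -EFinM densityZ //; case: ifP => _; last by rewrite mulr0.
  by rewrite mulrA powRN mulfV ?mul1r // gt_eqF // powR_gt0.
- apply/measurable_EFinP; apply: measurable_fun_ifT.
  + rewrite (_ : (fun _ => _) = (P \o phi) \o sc l).
      exact: measurableT_comp (rV_scM H l).
    by apply/funext => x /=; rewrite (rV_scE H).
  + rewrite (_ : (fun _ => _) = (density \o phi) \o sc l).
      by apply: measurableT_comp (rV_scM H l); exact: densityM.
    by apply/funext => x /=; rewrite (rV_scE H).
  + exact: measurable_cst.
- by move=> x _; exact: mass_integrand_ge0 (P) _.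
- by rewrite lee_fin powR_ge0.
Qed.

Lemma covolumeE (E : set 'rV[R]_n) : measurable (phi @^-1` E) ->
  covolume C Theta E = mass (fun v => ~~ `[< E v >]).
Proof.
move=> mE; rewrite /mass.
pose f v : \bar R := (if ~~ `[< E v >] then density v else 0)%:E.
have mf : measurable_fun setT (f \o phi).
  apply: (@mass_integrandM (fun v => ~~ `[< E v >])).
  by apply: measurable_neg; exact: (measurable_asbool mE).
have f0 v : (0 <= f v)%E by exact: (@mass_integrand_ge0 (fun v => ~~ `[< E v >])).
rewrite -(rV_intE H (f := f)) //.
(* The covolume integrand uses [Theta], the mass uses [density]; they can differ only at the
   origin. *)
apply: (rV_int_off0 H (ltnW n2) f0 mf).
move=> v v0; rewrite /f; case: ifPn => [/set_mem[Cv Ev]|nv].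
  by rewrite asboolF // densityE.
case: asboolP => //= Ev; rewrite /density ifN //.
apply: contra nv => /set_mem[Cv _]; exact/mem_set.
Qed.

(** * Radial function and masses attached to one pseudo-cone *)

Section one_set.
Variable E : set 'rV[R]_n.
Hypothesis HE : pseudo_cone C E.

Lemma pseudo_coneM : measurable (phi @^-1` E).
Proof. exact: (rV_closedM H (pseudo_cone_closed HE)). Qed.

Lemma pseudo_coneZM (t : R) : measurable [set x | E (t *: phi x)].
Proof.
rewrite (_ : mkset _ = sc t @^-1` (phi @^-1` E)).
  by rewrite -[X in measurable X]setTI; apply: (rV_scM H) => //; exact: pseudo_coneM.
by apply/seteqP; split => x /=; rewrite (rV_scE H).
Qed.

Lemma reachM : measurable [set x | reach E (phi x)].
Proof.
(* Integer factors suffice, as a ray stays in [E] once it has entered it. *)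
rewrite (_ : mkset _ = \bigcup_k [set x | E (k.+1%:R *: phi x)]).
  by apply: bigcupT_measurable => k; exact: pseudo_coneZM.
apply/seteqP; split => x /=.
  move=> [r [r0 Er]]; exists (Num.truncn r) => //=.
  apply: (pseudo_cone_up HE r0 _ Er); apply: ltW.
  by have /truncn_itv/andP[_] := ltW r0.
by move=> [k _ Ek]; exists k.+1%:R.
Qed.

Lemma radialM : measurable_fun setT (radial E \o phi).
Proof.
move=> _; apply: (measurability _ (RGenOInfty.measurableE R)) => //.
move=> _ [_ [t ->] <-]; rewrite setTI.
(* Because of the default value 0, the superlevel set is everything for [t < 0], the reached vectors
   not sent into [E] by [t] for [t > 0], and all reached vectors for [t = 0]. *)
have [t0|t0|->] := ltgtP t 0.
- rewrite (_ : _ @^-1` _ = setT) //; apply/seteqP; split => // x _ /=.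
  by rewrite in_itv /= andbT (lt_le_trans t0) // radial_ge0.
- rewrite (_ : _ @^-1` _ = [set x | reach E (phi x)] `\` [set x | E (t *: phi x)]).
    by apply: measurableD; [exact: reachM|exact: pseudo_coneZM].
  apply/seteqP; split => x /=; rewrite in_itv /= andbT.
    move=> lt_r; have rx : reach E (phi x).
      apply: contrapT => nr; move: lt_r; rewrite /radial asboolF //.
      by rewrite ltNge ltW.
    by split => // /(radial_le HE rx t0); rewrite leNgt lt_r.
  move=> [rx nE]; rewrite ltNge; apply/negP => /(radial_le HE rx t0).
  exact: nE.
- rewrite (_ : _ @^-1` _ = [set x | reach E (phi x)]); first exact: reachM.
  apply/seteqP; split => x /=; rewrite in_itv /= andbT; last exact: (radial_gt0 HE).
  move=> r0; apply: contrapT => nr; move: r0; by rewrite /radial asboolF // ltxx.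
Qed.

(* The unreached part of C is a cone contained in the complement of E; scaling
   by 2 multiplies its finite mass by 2^-p < 1. *)
Lemma unreached_mass0 : (covolume C Theta E < +oo)%E ->
  mass (fun v => ~~ `[< reach E v >]) = 0%E.
Proof.
rewrite covolumeE; last exact: pseudo_coneM.
move=> fin.
have mP : measurable_fun setT ((fun v => ~~ `[< reach E v >]) \o phi).
  by apply: measurable_neg; exact: (measurable_asbool reachM).
have Zfin : (mass (fun v => ~~ `[< reach E v >]) < +oo)%E.
  apply: le_lt_trans fin; apply: le_mass => v; apply: contra => /asboolP Ev.
  by apply/asboolP; exists 1; rewrite scale1r.
have := massZ (ltr0n R 2) mP.
rewrite (_ : (fun v => _) = (fun v => ~~ `[< reach E v >])); last first.
  apply/funext => v; congr (~~ _); apply: asbool_equiv_eq.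
  by apply: reachZ; rewrite ltr0n.
move: Zfin (mass_ge0 (fun v => ~~ `[< reach E v >])).
case: (mass _) => [z|//|//] _; rewrite lee_fin => z0; rewrite -EFinM => -[] zE.
have l1 : 2 `^ (- p) < 1 :> R.
  rewrite powRN invf_lt1 ?powR_gt0 //.
  apply: (@lt_le_trans _ _ (2 `^ 1)); first by rewrite powRr1 // ltr1n.
  by rewrite ler_powR ?ler1n.
congr EFin; apply/eqP; rewrite eq_le z0 andbT; nra.
Qed.

(** Halfway to [E] along an interior direction of [C] there is a point outside [E]; it has an open
    neighbourhood [U] on which the density is positive. *)
Lemma complement_mass_gt0 : (0 < mass (fun v => ~~ `[< E v >]))%E.
Proof.
rewrite lt_def mass_ge0 andbT; apply/eqP => m0.
have [_ _ scC _ [c ic]] := HC.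
have rc := interior_reach HC HE ic.
have rc0 := radial_gt0 HE rc.
pose l := radial E c / 2.
have l0 : 0 < l by rewrite divr_gt0.
have nE : ~ E (l *: c).
  by move/(radial_le HE rc l0); rewrite /l; lra.
pose U := (fun v => l^-1 *: v) @^-1` (interior C) `&` ~` E.
have oU : open U.
  apply: openI; last exact: closed_openC (pseudo_cone_closed HE).
  apply: open_comp; last exact: open_interior.
  by move=> v _; exact: scaler_continuous.
have U0 : U !=set0.
  by exists (l *: c); split => //=; rewrite scalerA mulVf ?gt_eqF // scale1r.
have := rV_open_gt0 H oU U0; apply/negP; rewrite -leNgt.
have mf : measurable_fun setT (fun x => if ~~ `[< E (phi x) >] then density (phi x) else 0).
  apply/measurable_EFinP; apply: (@mass_integrandM (fun v => ~~ `[< E v >])).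
  by apply: measurable_neg; exact: (measurable_asbool pseudo_coneM).
rewrite -(integral_eq0_support _ mf m0); last first.
  by move=> x; rewrite -lee_fin; exact: (@mass_integrand_ge0 (fun v => ~~ `[< E v >])).
apply: le_measure; rewrite ?inE.
- exact: (rV_openM H).
- rewrite -[X in measurable X]setTI.
  exact: (measurable_fun_ltr (@measurable_cst _ _ _ _ _ (0 : R)) mf).
move=> x [iv nEx] /=; rewrite asboolF //=.
have rv : reach E (phi x).
  by apply/(@reachZ R n E l^-1 (phi x)); rewrite ?invr_gt0 //; exact: interior_reach iv.
have Cv := reach_cone HC HE rv; have v0 := reach_neq0 HE rv.
by rewrite densityE // T_gt0.
Qed.

End one_set.

Lemma reach_add (A : set 'rV[R]_n) x y : pseudo_cone C A ->
  C x -> reach A y -> reach A (x + y).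
Proof.
move=> HA Cx [r [r0 Ar]]; exists r; split=> //.
rewrite addrC scalerDr; apply: (pseudo_coneD HA) => //.
by have [_ _ scC _ _] := HC; apply: scC => //; exact: ltW.
Qed.

Lemma covolume_dilate (E : set 'rV[R]_n) l : pseudo_cone C E -> 0 < l ->
  covolume C Theta (dilate l E) = ((l `^ p)%:E * covolume C Theta E)%E.
Proof.
move=> HE l0.
have dE v : dilate l E v <-> E (l^-1 *: v).
  split=> [[w Ew <-]|Ev]; first by rewrite scalerA mulVf ?gt_eqF // scale1r.
  by exists (l^-1 *: v) => //; rewrite scalerA mulfV ?gt_eqF // scale1r.
rewrite !covolumeE; last 2 first.
- exact: pseudo_coneM.
- rewrite (_ : _ @^-1` _ = [set x | E (l^-1 *: phi x)]); first exact: pseudo_coneZM.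
  by apply/seteqP; split => x /= /dE.
rewrite (_ : (fun v => ~~ `[< dilate l E v >]) = (fun v => ~~ `[< E (l^-1 *: v) >])).
  rewrite (@massZ (fun v => ~~ `[< E v >])) ?invr_gt0 //.
    by rewrite -(powR_inv1 (ltW l0)) -powRrM mulN1r opprK.
  by apply: measurable_neg; exact: (measurable_asbool (pseudo_coneM HE)).
by apply/funext => v; congr (~~ _); exact: asbool_equiv_eq.
Qed.

(* Pushing a counterexample x into the interior of C and dilating it slightly
   gives a nonempty open set U on which the three inequalities hold. *)
Lemma noncrossing_sub (A B : set 'rV[R]_n) (h : 'rV[R]_n -> R) (a b : R) x :
  pseudo_cone C A -> pseudo_cone C B -> 0 < a -> 0 < b ->
  (forall v, reach A v -> reach B v -> 0 < h v) ->
  m.-negligible [set y |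
    [/\ 0 < h (phi y), a < radial A (phi y) & radial B (phi y) < b]] ->
  B x -> A ((a / b) *: x).
Proof.
move=> HA HB a0 b0 hpos null Bx; apply: contrapT => nA.
have [_ _ scC _ [c ic]] := HC.
have oA : open (~` A) by exact: closed_openC (pseudo_cone_closed HA).
have cv : (a * ((1 + e) / b)) *: (x + e *: c) @[e --> (0 : R)^'+] --> (a / b) *: x.
  apply: cvg_at_right_filter; apply: cvgZ.
    rewrite (_ : a / b = a * ((1 + 0) / b)); last by rewrite addr0 mul1r.
    apply: cvgM; first exact: cvg_cst.
    apply: cvgM; last exact: cvg_cst.
    by apply: cvgD; [exact: cvg_cst|exact: cvg_id].
  rewrite -[X in _ --> X]addr0 -(scale0r c).
  by apply: cvgD; [exact: cvg_cst|apply: cvgZr_tmp; exact: cvg_id].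
have [e [e0 nAe]] : exists e : R, 0 < e /\ ~ A ((a * ((1 + e) / b)) *: (x + e *: c)).
  near (0 : R)^'+ => e; exists e; split; first by near: e; exact: nbhs_right_gt.
  near: e; apply: (cv (~` A)); exact: (open_nbhs_nbhs (conj oA nA)).
(* The point [k^-1 *: (x + e *: c)] is sent outside [A] by the factor [a] and into [B] by the factor
   [k]; as [k < b], its radial value for [B] is strictly below [b]. *)
pose k := b / (1 + e).
have e1 : 0 < 1 + e by rewrite addr_gt0.
have k0 : 0 < k by rewrite divr_gt0.
have kb : k < b by rewrite ltr_pdivrMr // ltr_pMr // ltrDl.
pose g (v : 'rV[R]_n) := e^-1 *: (k *: v - x).
pose U := (fun v => a *: v) @^-1` (~` A) `&` g @^-1` (interior C).
have oU : open U.
  apply: openI; apply: open_comp => //.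
  - by move=> v _; exact: scaler_continuous.
  - move=> v _; apply: (continuous_comp (f := fun v : 'rV[R]_n => k *: v - x)
        (g := fun v : 'rV[R]_n => e^-1 *: v)); last exact: scaler_continuous.
    have ck : k *: w @[w --> v] --> k *: v by exact: scaler_continuous.
    exact: (cvgB ck (cvg_cst x)).
  - exact: open_interior.
have U0 : U !=set0.
  exists (k^-1 *: (x + e *: c)); split => /=.
    by rewrite scalerA /k invf_div.
  rewrite /g scalerA mulfV ?gt_eqF // scale1r addrAC subrr add0r.
  by rewrite scalerA mulVf ?gt_eqF // scale1r.
have : m.-negligible (phi @^-1` U).
  apply: negligibleS null => y [/= nAy ig].
  have kE : k *: phi y = x + e *: g (phi y).
    by rewrite /g scalerA mulfV ?gt_eqF // scale1r addrC subrK.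
  have Cx := pseudo_cone_sub HB Bx.
  have re (D : set 'rV[R]_n) : pseudo_cone C D -> reach D (phi y).
    move=> HD; apply/(@reachZ _ _ D k (phi y) k0); rewrite kE.
    apply: reach_add => //; apply/(@reachZ _ _ D e (g (phi y)) e0).
    exact: (interior_reach HC HD ig).
  split.
  - by apply: hpos; exact: re.
  - by rewrite ltNge; apply/negP => /(radial_le HA (re _ HA) a0).
  - apply: le_lt_trans kb; apply/(radial_le HB (re _ HB) k0); rewrite kE.
    apply: (pseudo_coneD HB) => //; apply: scC; last exact: ltW.
    exact: interior_subset.
move/negligibleP => /(_ (rV_openM H oU)) mU.
by have := rV_open_gt0 H oU U0; rewrite mU ltxx.
Unshelve. all: by end_near.
Qed.

(** * Brunn-Minkowski inequality for two close sets *)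

Section two_sets.
Variables E1 E2 : set 'rV[R]_n.
Hypotheses (H1 : pseudo_cone C E1) (H2 : pseudo_cone C E2).
Hypotheses (fin1 : (covolume C Theta E1 < +oo)%E).
Hypotheses (fin2 : (covolume C Theta E2 < +oo)%E).

Let both v := `[< reach E1 v >] && `[< reach E2 v >].
(** The density cut down to vectors reached by both sets, where neither radial function takes its
    default value. *)
Let h v := if both v then density v else 0.

Let h0 x : 0 <= (h \o phi) x.
Proof. by rewrite /= /h; case: ifP => // _; exact: density_ge0. Qed.

Let hM : measurable_fun setT (h \o phi).
Proof.
apply: measurable_fun_ifT => //; last exact: densityM.
by apply: measurable_and; exact: (measurable_asbool (reachM _)).
Qed.

(** Passing from [density] to [h] loses at most the densities [f1] and [f2] on the two unreached
    parts, both of mass 0. *)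
Let massE (P : 'rV[R]_n -> bool) : measurable_fun setT (P \o phi) ->
  mass P = (\int[m]_x (if P (phi x) then h (phi x) else 0)%:E)%E.
Proof.
move=> mP; apply/eqP; rewrite eq_le; apply/andP; split; last first.
  apply: le_integral_pointwise => x; rewrite lee_fin /h.
  by case: ifP => // _; case: ifP => // _; exact: density_ge0.
have mh : measurable_fun setT (fun x => (if P (phi x) then h (phi x) else 0)%:E).
  by apply/measurable_EFinP; apply: measurable_fun_ifT.
have z1 := unreached_mass0 H1 fin1; have z2 := unreached_mass0 H2 fin2.
pose f1 x := (if ~~ `[< reach E1 (phi x) >] then density (phi x) else 0)%:E.
pose f2 x := (if ~~ `[< reach E2 (phi x) >] then density (phi x) else 0)%:E.
have mf1 : measurable_fun setT f1.
  apply: (@mass_integrandM (fun v => ~~ `[< reach E1 v >])).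
  by apply: measurable_neg; exact: (measurable_asbool (reachM H1)).
have mf2 : measurable_fun setT f2.
  apply: (@mass_integrandM (fun v => ~~ `[< reach E2 v >])).
  by apply: measurable_neg; exact: (measurable_asbool (reachM H2)).
have f10 x : (0 <= f1 x)%E by exact: (@mass_integrand_ge0 (fun v => ~~ `[< reach E1 v >])).
have f20 x : (0 <= f2 x)%E by exact: (@mass_integrand_ge0 (fun v => ~~ `[< reach E2 v >])).
have hp0 x : (0 <= (if P (phi x) then h (phi x) else 0)%:E)%E.
  by rewrite lee_fin; case: ifP => // _; exact: h0.
have -> : (\int[m]_x (if P (phi x) then h (phi x) else 0)%:E =
    \int[m]_x ((if P (phi x) then h (phi x) else 0)%:E + (f1 x + f2 x)))%E.
  rewrite ge0_integralD //; last 2 first.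
  - by move=> x _; rewrite adde_ge0.
  - exact: emeasurable_funD.
  rewrite ge0_integralD //.
  have -> : (\int[m]_x f1 x = 0)%E by exact: z1.
  have -> : (\int[m]_x f2 x = 0)%E by exact: z2.
  by rewrite !adde0.
apply: le_integral_pointwise => x; rewrite -!EFinD lee_fin /h /both.
have dx := density_ge0 (phi x).
by case: (P _); case: `[< _ >]; case: `[< _ >] => /=; lra.
Qed.

Let superlevelE (r : 'rV[R]_n -> R) t : measurable_fun setT (r \o phi) ->
  superlevel_mass m (h \o phi) (r \o phi) t = mass (fun v => t < r v).
Proof.
move=> mr; rewrite massE //.
exact: (measurable_fun_ltr (@measurable_cst _ _ _ _ _ t) mr).
Qed.

Let superlevel_homogeneous (r : 'rV[R]_n -> R) :
  measurable_fun setT (r \o phi) -> (forall l v, 0 < l -> r (l *: v) = r v / l) ->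
  homogeneous_mass m (h \o phi) p (r \o phi).
Proof.
move=> mr rZ t t0; rewrite !superlevelE // -massZ //; last first.
  exact: (measurable_fun_ltr (@measurable_cst _ _ _ _ _ (1 : R)) mr).
by congr mass; apply/funext => v; rewrite rZ // ltr_pdivlMr // mul1r.
Qed.

Let rM E : pseudo_cone C E -> measurable_fun setT (radial E \o phi).
Proof. exact: radialM. Qed.

Let covolume_superlevel E : pseudo_cone C E -> (forall v, both v -> reach E v) ->
  covolume C Theta E = superlevel_mass m (h \o phi) (radial E \o phi) 1.
Proof.
move=> HE bE; rewrite (covolumeE (pseudo_coneM HE)) massE; last first.
  by apply: measurable_neg; exact: (measurable_asbool (pseudo_coneM HE)).
apply: eq_integral => x _; congr EFin; rewrite /= /h.
case bx: (both _); last by rewrite !if_same.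
have rx := bE _ bx; have := radial_le HE rx (ltr01 : 0 < (1 : R)).
rewrite scale1r => rE; congr (if _ then _ else _).
by rewrite ltNge; congr (~~ _); apply/asboolP/idP => /rE.
Qed.

Let rsum v := radial E1 v + radial E2 v.

Let rsumM : measurable_fun setT (rsum \o phi).
Proof.
by apply: (@measurable_funD _ _ _ _ (radial E1 \o phi) (radial E2 \o phi)); exact: rM.
Qed.

Let covolume_sum_le :
  (covolume C Theta (minkowski_sum E1 E2) <=
   superlevel_mass m (h \o phi) (rsum \o phi) 1)%E.
Proof.
(* [P] is the complement of a measurable set that [radial_sum] places inside the Minkowski sum;
   bounding the covolume by its mass only compares integrands pointwise. *)
pose P v := ~~ (both v && (rsum v <= 1)).
have mP : measurable_fun setT (P \o phi).
  apply: measurable_neg; apply: measurable_and.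
    by apply: measurable_and; exact: (measurable_asbool (reachM _)).
  exact: (measurable_fun_ler rsumM (@measurable_cst _ _ _ _ _ (1 : R))).
have -> : superlevel_mass m (h \o phi) (rsum \o phi) 1 = mass P.
  rewrite massE //; apply: eq_integral => x _; congr EFin; rewrite /P /h /=.
  by case: (both _) => /=; rewrite ?if_same // ltNge.
pose f v : \bar R := (if P v then density v else 0)%:E.
have f0 v : (0 <= f v)%E by exact: mass_integrand_ge0.
rewrite /mass -(rV_intE H (f := f)) //; last exact: mass_integrandM.
(* The value at the origin is raised to dominate the arbitrary [Theta 0]; the integral does not
   change. *)
pose g v : \bar R := if v == 0 then `|Theta 0|%:E else f v.
have <- : lebesgue_int_rV g = lebesgue_int_rV f.
  apply: (rV_int_off0 H (ltnW n2) f0 (mass_integrandM mP)).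
  by move=> v /negPf v0; rewrite /g v0.
apply: lebesgue_int_rV_le => v; rewrite /g; case: eqVneq => [->|v0].
  by case: ifP => _; rewrite lee_fin ?ler_norm.
case: ifPn => [/set_mem[Cv nv]|//]; rewrite /f.
have -> : P v.
  apply/negP => /andP[/andP[/asboolP r1 /asboolP r2] le1].
  by apply: nv; exact: (radial_sum H1 H2).
by rewrite densityE.
Qed.

Let covolume_sum_ge0 : (0 <= covolume C Theta (minkowski_sum E1 E2))%E.
Proof.
apply: lebesgue_int_rV_ge0_off0; first exact: ltnW.
move=> v v0; case: ifPn => [/set_mem[Cv _]|//].
by rewrite lee_fin ltW // T_gt0.
Qed.

(** The covolumes are extracted as real numbers, so that roots become [powR]. Equality is turned
    into two inclusions by excluding crossings in both directions. *)
Lemma covolume_brunn_minkowski : exists v1 v2 v : R,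
  let a := v1 `^ p^-1 in let b := v2 `^ p^-1 in
  [/\ [/\ covolume C Theta E1 = v1%:E, covolume C Theta E2 = v2%:E &
        covolume C Theta (minkowski_sum E1 E2) = v%:E],
      [/\ 0 < v1, 0 < v2 & 0 <= v], v <= (a + b) `^ p &
      1 < p -> v = (a + b) `^ p ->
      (forall x, E2 x -> E1 ((a / b) *: x)) /\
      (forall x, E1 x -> E2 ((b / a) *: x))].
Proof.
have b1 v : both v -> reach E1 v by move=> /andP[/asboolP].
have b2 v : both v -> reach E2 v by move=> /andP[_ /asboolP].
have W1 := covolume_superlevel H1 b1; have W2 := covolume_superlevel H2 b2.
have p1' : (0 < covolume C Theta E1)%E.
  by rewrite (covolumeE (pseudo_coneM H1)); exact: complement_mass_gt0.
have p2' : (0 < covolume C Theta E2)%E.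
  by rewrite (covolumeE (pseudo_coneM H2)); exact: complement_mass_gt0.
move: covolume_sum_le covolume_sum_ge0 W1 W2 fin1 fin2 p1' p2'.
case: (covolume C Theta E1) => [v1|//|//]; case: (covolume C Theta E2) => [v2|//|//].
move=> le12 ge12 /esym W1 /esym W2 _ _; rewrite !lte_fin => v10 v20.
have hr1 : homogeneous_mass m (h \o phi) p (radial E1 \o phi).
  by apply: superlevel_homogeneous; [exact: rM|exact: (radialZ H1)].
have hr2 : homogeneous_mass m (h \o phi) p (radial E2 \o phi).
  by apply: superlevel_homogeneous; [exact: rM|exact: (radialZ H2)].
have hr : homogeneous_mass m (h \o phi) p (rsum \o phi).
  apply: superlevel_homogeneous => // l v l0.
  by rewrite /rsum (radialZ H1) // (radialZ H2) // mulrDl.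
pose a := v1 `^ p^-1; pose b := v2 `^ p^-1.
have a0 : 0 < a by rewrite powR_gt0.
have b0 : 0 < b by rewrite powR_gt0.
have W_le : (superlevel_mass m (h \o phi) (rsum \o phi) 1 <= ((a + b) `^ p)%:E)%E.
  (* For [p = 1] the roots [a] and [b] are [v1] and [v2], and the logarithmic comparison applies;
     otherwise the convex one does. *)
  have := p1; rewrite le_eqVlt => /orP[/eqP pE|plt].
    rewrite -pE invr1 in a b a0 b0 *.
    rewrite powRr1 ?addr_ge0 ?(ltW a0) ?(ltW b0) // /a /b !powRr1 ?(ltW v10) ?(ltW v20) //.
    rewrite -pE in hr1 hr2 hr.
    exact: (subadditive_mass h0 hM (rM H1) (rM H2) hr1 hr2 hr W1 W2).
  by have [] := minkowski_mass h0 hM plt v10 v20 (rM H1) (rM H2) hr1 hr2 hr W1 W2.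
have := le_trans le12 W_le.
move: le12 ge12; case: (covolume C Theta _) => [v|//|//] le12.
rewrite !lee_fin => v0 vle.
exists v1, v2, v; split => // plt vE.
have WE : superlevel_mass m (h \o phi) (rsum \o phi) 1 = ((a + b) `^ p)%:E.
  by apply/eqP; rewrite eq_le W_le -vE.
have hpos v' : reach E1 v' -> reach E2 v' -> 0 < h v'.
  move=> r1 r2; rewrite /h /both !asboolT //= densityE ?T_gt0 //.
  - exact: (reach_cone HC H1 r1).
  - exact: (reach_neq0 H1 r1).
  - exact: (reach_cone HC H1 r1).
  - exact: (reach_neq0 H1 r1).
have mr1 := rM H1; have mr2 := rM H2.
have [_ /(_ WE) null1] := minkowski_mass h0 hM plt v10 v20 mr1 mr2 hr1 hr2 hr W1 W2.
have rsumC : (rsum \o phi) = (fun x => (radial E2 \o phi) x + (radial E1 \o phi) x).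
  by apply/funext => x; rewrite /rsum /= addrC.
(* The roles of the sets are exchanged to obtain the opposite crossing. *)
have [_] : _ /\ _ := minkowski_mass h0 hM plt v20 v10 mr2 mr1 hr2 hr1
  (eq_ind _ (homogeneous_mass m (h \o phi) p) hr _ rsumC) W2 W1.
rewrite -rsumC [X in X `^ p]addrC => /(_ WE) null2.
split => x Ex.
  apply: (noncrossing_sub (h := h) H1 H2 a0 b0 hpos _ Ex).
  by apply/negligibleP => //; exact: crossing_measurable.
apply: (noncrossing_sub (h := h) H2 H1 b0 a0 (fun v r2 r1 => hpos v r1 r2) _ Ex).
by apply/negligibleP => //; exact: crossing_measurable.
Qed.

End two_sets.

End cone_mass.

(** * Taking roots, and characterising equality by dilates *)

Theorem theorem1p3 (R : realType) (n : nat) (C : set 'rV[R]_n)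
  (q : R) (Theta : 'rV[R]_n -> R) (E1 E2 : set 'rV[R]_n) :
  (2 <= n)%N ->
  pointed_cone C ->
  0 <= q -> q <= n%:R - 1 ->
  {within C `\ 0, continuous Theta} ->
  (forall x, C x -> x != 0 -> 0 < Theta x) ->
  (forall x (t : R), C x -> x != 0 -> 0 < t ->
     Theta (t *: x) = t `^ (- q) * Theta x) ->
  close_set C Theta E1 -> close_set C Theta E2 ->
  (poweR (covolume C Theta (minkowski_sum E1 E2)) (n%:R - q)^-1 <=
     poweR (covolume C Theta E1) (n%:R - q)^-1
     + poweR (covolume C Theta E2) (n%:R - q)^-1)%E /\
  (q < n%:R - 1 ->
    (poweR (covolume C Theta (minkowski_sum E1 E2)) (n%:R - q)^-1 =
       poweR (covolume C Theta E1) (n%:R - q)^-1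
       + poweR (covolume C Theta E2) (n%:R - q)^-1)%E
    <-> exists l : R, 0 < l /\ E2 = dilate l E1).
Proof.
move=> n2 HC q0 qn cT T0 TZ [H1 fin1] [H2 fin2].
have [d [T [m [phi [sc H]]]]] := rV_model_exists R n.
have [v1 [v2 [v /= [[cE1 cE2 cE12] [v10 v20 v0] vle eqc]]]] :=
  covolume_brunn_minkowski n2 HC qn cT T0 TZ H H1 H2 fin1 fin2.
have cdil := covolume_dilate n2 HC cT T0 TZ H H1.
move: vle eqc cdil; set p := n%:R - q => vle eqc cdil.
have p0 : 0 < p by rewrite (@lt_le_trans _ _ 1) // /p; lra.
have pn0 : p != 0 by rewrite gt_eqF.
have powK (x : R) : 0 <= x -> (x `^ p) `^ p^-1 = x.
  by move=> x0; rewrite -powRrM mulfV // powRr1.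
have powVK (x : R) : 0 <= x -> (x `^ p^-1) `^ p = x.
  by move=> x0; rewrite -powRrM mulVf // powRr1.
move: vle eqc; set a := v1 `^ p^-1; set b := v2 `^ p^-1 => vle eqc.
have a0 : 0 < a by rewrite powR_gt0.
have b0 : 0 < b by rewrite powR_gt0.
have ab0 : 0 <= a + b by rewrite addr_ge0 // ltW.
rewrite cE1 cE2 cE12 /= -EFinD; split.
  rewrite lee_fin -/a -/b -[leRHS]powK //.
  by apply: ge0_ler_powR; rewrite ?nnegrE ?powR_ge0 // invr_ge0 ltW.
move=> qlt; split=> [[vE]|[l [l0 E2E]]].
  (* Raising the equality of roots to the power [p] gives the equality of covolumes required by
     [eqc]; the two inclusions then say that [E2] is the dilate of [E1] by [b / a]. *)
  have [sub12 sub21] : (forall x, E2 x -> E1 ((a / b) *: x)) /\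
      (forall x, E1 x -> E2 ((b / a) *: x)).
    by apply: eqc; [rewrite /p; lra|rewrite -vE powVK].
  exists (b / a); split; first by rewrite divr_gt0.
  apply/seteqP; split => [x Ex|_ [x Ex <-]]; last exact: sub21.
  exists ((a / b) *: x); first exact: sub12.
  by rewrite scalerA mulrA divfK ?gt_eqF // mulfV ?gt_eqF // scale1r.
(* Conversely the sum is the dilate of [E1] by [1 + l], and the root of the covolume scales linearly
   under dilation. *)
move: cE2 cE12; rewrite E2E minkowski_sum_dilate //; last exact: pseudo_cone_convex H1.
rewrite !cdil ?addr_gt0 // cE1 -!EFinM => -[v2E] [vE].
congr EFin; rewrite -vE -/a /b -v2E !powRM ?powR_ge0 ?(ltW v10) // !powK ?(ltW l0) //.
  by rewrite mulrDl mul1r.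
by rewrite addr_ge0 // ltW.
Qed.
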